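(* Let $G$ be a non-abelian infinite supersoluble group. Then every non-abelian subgroup $H$ of $G$ satisfies $C_G(H)\le H$ if and only if the following holds: $G=A\langle x\rangle$, where $x$ has order $2^n$ for some $n$, $A=\langle a_1\rangle\times\dots\times\langle a_t\rangle\times\langle d\rangle$ is an abelian subgroup with each $a_i$ of infinite or odd order, $d$ has order $2^h$ for some $h\ge 0$ (and $d^{2^{h-1}}=x^{2^{n-1}}$ if $h>0$), and $a^x=a^{-1}$ for all $a\in A$.
   Context: A group is supersoluble if it has a normal series (each term normal in the whole group) with cyclic factors. $C_G(H)$ denotes the centralizer of $H$ in $G$; $a^x=x^{-1}ax$. *)

(* Defs.v *)
From HB Require Import structures.
From mathcomp Require Import all_boot.
Set Implicit Arguments.
Unset Strict Implicit.
Unset Printing Implicit Defensive.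

(* Groups are MathComp's (possibly infinite) [groupType] from boot/monoid.v.
   The ambient group G of the paper is the whole carrier type [gT].
   Subsets of a group are Prop-valued predicates [gT -> Prop]. *)

Local Open Scope group_scope.

Section Defs.
Variable gT : groupType.
Implicit Types (x y z : gT) (H K : gT -> Prop).

Definition is_subgroup H : Prop :=
  H 1 /\ (forall x y, H x -> H y -> H (x * y)) /\ (forall x, H x -> H x^-1).

Definition normal_in_all H : Prop := forall x g, H x -> H (x ^ g).

Definition in_cyclic y z : Prop := exists n : nat, z = y ^+ n \/ z = y ^- n.

Definition cyclic_factor H K : Prop :=
  exists2 y, K y & forall z, K z -> exists2 c, in_cyclic y c & H (z * c^-1).

Definition trivial_subgroup : gT -> Prop := fun z => z = 1.
Definition whole_group : gT -> Prop := fun _ => True.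

Definition supersoluble : Prop :=
  exists s : seq (gT -> Prop),
    [/\ (forall i, i < size s -> is_subgroup (nth whole_group s i)
                                /\ normal_in_all (nth whole_group s i)),
        forall z, nth whole_group s 0 z <-> z = 1,
        forall z, nth trivial_subgroup s (size s).-1 z,
        0 < size s &
        forall i, i.+1 < size s ->
          (forall z, nth whole_group s i z -> nth whole_group s i.+1 z) /\
          cyclic_factor (nth whole_group s i) (nth whole_group s i.+1)].

Definition infinite_group : Prop := ~ exists s : seq gT, forall x, x \in s.

Definition nonabelian H : Prop := exists x y, H x /\ H y /\ x * y <> y * x.

Definition centralizer_le H : Prop :=
  forall g, (forall h, H h -> g * h = h * g) -> H g.

Definition has_order x (m : nat) : Prop :=
  0 < m /\ x ^+ m = 1 /\ forall k, 0 < k < m -> x ^+ k <> 1.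
Definition infinite_order x : Prop := forall k, 0 < k -> x ^+ k <> 1.

(* the subgroup <g_1> ... <g_k> generated by pairwise commuting elements:
   the set of products c_1 * ... * c_k with c_i in <g_i> *)
Definition cyc_product (gs : seq gT) z : Prop :=
  exists cs : seq gT, size cs = size gs /\
    (forall i, i < size gs -> in_cyclic (nth 1 gs i) (nth 1 cs i)) /\
    z = \prod_(c <- cs) c.

Definition direct_cyc (gs : seq gT) : Prop :=
  (forall i j, i < size gs -> j < size gs ->
      nth 1 gs i * nth 1 gs j = nth 1 gs j * nth 1 gs i) /\
  (forall cs : seq gT, size cs = size gs ->
      (forall i, i < size gs -> in_cyclic (nth 1 gs i) (nth 1 cs i)) ->
      \prod_(c <- cs) c = 1 -> forall i, i < size cs -> nth 1 cs i = 1).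

End Defs.

(* Main.v *)
(* The direct implication rests on one element c of infinite order with <c> normal, found
   above a finite normal subgroup in the first infinite factor of the series.

   C(c) is abelian: otherwise it contains b, y with [b, y] a nontrivial element
   of an abelian normal subgroup B, and for all k in some progression 1 + M l the
   subgroup B^k <y^k> is nonabelian, so it contains c; this makes c a k-th power,
   whereas in a polycyclic group an element of infinite order has no k-th roots
   for large k.

   So any x outside C(c) inverts c. For odd r the subgroup <c, x^r> is nonabelian
   and contains the centre, which forces the centre into <x^(2r)>; hence x has
   order a power of 2 and the centre is <x^2>. As b b^x is central for b in C(c),
   C(c) = A <x^2>, where A is the set of elements of C(c) inverted by x. The
   involutions of A are central, so there is at most one, and the 2-part of a
   decomposition of A into cyclic groups is cyclic. *)
Require Import Defs.
From HB Require Import structures.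
From mathcomp Require Import all_boot all_order all_algebra zify ring boolp.
Set Implicit Arguments.
Unset Strict Implicit.
Unset Printing Implicit Defensive.
Import GRing.Theory Num.Theory.
Local Open Scope group_scope.

(** * Finitely generated abelian groups *)

Section AdditiveSpan.
Local Open Scope ring_scope.
Variable V : zmodType.
Implicit Types (g d u v z : V) (s t : seq V).

Fixpoint span s v : Prop :=
  if s is g :: s' then exists m : int, exists2 z, span s' z & v = g *~ m + z
  else v = 0.

(** Directness of the sum of the cyclic groups, not freeness: torsion generators, and even 0, are
    allowed. *)
Fixpoint indep s : Prop :=
  if s is g :: s' then
    (forall (m : int) z, span s' z -> g *~ m + z = 0 -> g *~ m = 0) /\ indep s'
  else True.

Lemma span0 s : span s 0.
Proof. by elim: s => //= g s IH; exists 0; exists 0; rewrite ?mulr0z ?addr0. Qed.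

Lemma spanD s u v : span s u -> span s v -> span s (u + v).
Proof.
elim: s u v => [|g s IH] u v /=; first by move=> -> ->; rewrite addr0.
move=> [m [z hz ->]] [m' [z' hz' ->]]; exists (m + m'); exists (z + z'); first exact: IH.
by rewrite mulrzDr addrACA.
Qed.

Lemma spanZ s v (m : int) : span s v -> span s (v *~ m).
Proof.
elim: s v => [|g s IH] v /=; first by move=> ->; rewrite mul0rz.
move=> [k [z hz ->]]; exists (k * m); exists (z *~ m); first exact: IH.
by rewrite mulrzDl mulrzA.
Qed.

Lemma spanN s v : span s v -> span s (- v).
Proof. by move=> h; rewrite -[v]mulr1z -mulrNz; apply: spanZ. Qed.

Lemma spanW g s v : span s v -> span (g :: s) v.
Proof. by move=> h; exists 0; exists v; rewrite ?mulr0z ?add0r. Qed.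

Lemma span_head g s : span (g :: s) g.
Proof. by exists 1; exists 0; [exact: span0 | rewrite addr0]. Qed.

Lemma span_mem g s : g \in s -> span s g.
Proof.
elim: s => // h s IH; rewrite inE => /orP [/eqP->|/IH]; first exact: span_head.
exact: spanW.
Qed.

Lemma span_min s (P : V -> Prop) :
  P 0 -> (forall u v, P u -> P v -> P (u + v)) ->
  (forall u (m : int), P u -> P (u *~ m)) ->
  (forall g, g \in s -> P g) -> forall v, span s v -> P v.
Proof.
move=> P0 PD PZ; elim: s => [|g s IH] Pg v /=; first by move=> ->.
move=> [m [z hz ->]]; apply: PD; first by apply/PZ/Pg/mem_head.
by apply: IH hz => h hh; apply: Pg; rewrite inE hh orbT.
Qed.

Lemma span_sub s t : (forall g, g \in s -> span t g) -> forall v, span s v -> span t v.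
Proof. by apply: span_min; [exact: span0 | exact: spanD | move=> *; exact: spanZ]. Qed.

Lemma eq_mem_span s t v : s =i t -> span s v <-> span t v.
Proof.
by move=> e; split; apply: span_sub => g hg; apply: span_mem; rewrite (e, =^~ e).
Qed.

Lemma span_cat s t v : span s v -> span (s ++ t) v.
Proof. by apply: span_sub => g hg; apply: span_mem; rewrite mem_cat hg. Qed.

Lemma eq_span_cons g s t : (forall v, span s v <-> span t v) ->
  forall v, span (g :: s) v <-> span (g :: t) v.
Proof.
by move=> e v; split=> -[m [z /e hz ->]]; exists m; exists z.
Qed.

Lemma indep_swap g d s : indep (g :: d :: s) -> indep (d :: g :: s).
Proof.
move=> [hg [hd hs]]; split; last split=> //.
  move=> m z [k [z' hz' ->]] e.
  have gk: g *~ k = 0.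
    apply: (hg _ (d *~ m + z')); first by exists m; exists z'.
    by rewrite addrCA.
  by apply: (hd _ z') => //; rewrite -e gk add0r.
by move=> m z hz; apply: hg; apply: spanW.
Qed.

Lemma indep_rcons d s : indep (rcons s d) <-> indep (d :: s).
Proof.
elim: s => [|g s IH] //.
have e v : span (rcons s d) v <-> span (d :: s) v.
  by apply: eq_mem_span => w; rewrite mem_rcons.
split.
  move=> [hg /IH hs]; apply: indep_swap; split=> // m z /e; exact: hg.
move=> /indep_swap [hg hs]; split; last exact/IH.
by move=> m z /e; exact: hg.
Qed.

(** Minimising the head coefficient [m] over all generating families of [n + 1] elements takes the
    place of a Smith normal form. *)
Definition has_relation s0 (n m : nat) : Prop :=
  (0 < m)%N /\ exists g s, [/\ size s = n, forall v, span (g :: s) v <-> span s0 v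
    & exists2 z, span s z & g *~ m + z = 0].

(* Replacing [g] by [g + h q] turns the coefficient of [h] into its remainder
   modulo the coefficient of [g], which vanishes when the latter is minimal. *)
Lemma min_relation_dvd s0 n m g s1 s2 z1 z2 :
  (0 < m)%N -> (forall k, has_relation s0 n k -> (m <= k)%N) ->
  size (s1 ++ s2) = n -> (forall v, span (g :: s1 ++ s2) v <-> span s0 v) ->
  span s1 z1 -> span s2 z2 -> g *~ m + (z1 + z2) = 0 ->
  exists2 z0, span s2 z0 & z2 = z0 *~ m.
Proof.
move=> m0 mmin.
elim: s2 s1 z1 z2 => [|h s2 IH] s1 z1 z2 ss hs hz1 /=.
  by move=> ->; exists 0; rewrite ?mul0rz.
move=> [c [z hz ->]] e.
have hz' : span (rcons s1 h) (z1 + h *~ c).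
  apply: spanD; first by rewrite -cats1; apply: span_cat.
  by apply/spanZ/span_mem; rewrite mem_rcons mem_head.
have [||//||z0 hz0 ez0] := IH _ _ z _ _ hz'; rewrite ?cat_rcons //.
  by rewrite -addrA.
set q := (c %/ m)%Z; set r := (c %% m)%Z.
have m0' : (m : int) != 0 by rewrite eqz_nat -lt0n.
have ec : c = q * m + r by exact: divz_eq.
have r0 : 0 <= r by exact: modz_ge0.
have rm : r < m by rewrite ltz_pmod.
have r00 : r = 0.
  case: (r) r0 rm ec => [[//|k]|//] _ rm ec.
  suff : (m <= k.+1)%N by rewrite leqNgt; move: rm; rewrite ltz_nat => ->.
  apply: mmin; split=> //; exists h, ((g + h *~ q) :: s1 ++ s2); split.
  - by rewrite -ss /= !size_cat /= addnS.
  - move=> v; rewrite -hs; split; apply: span_sub => w; rewrite !inE mem_cat.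
      case/or4P=> [/eqP->|/eqP->|w1|w2].
      + by apply: span_mem; rewrite !inE mem_cat mem_head !orbT.
      + apply: spanD; first exact: span_head.
        by apply/spanZ/span_mem; rewrite !inE mem_cat mem_head !orbT.
      + by apply: span_mem; rewrite !inE mem_cat w1 orbT.
      + by apply: span_mem; rewrite !inE mem_cat inE w2 !orbT.
    case/or3P=> [/eqP->|w1|].
    + have eg : h *~ (- q) + (g + h *~ q) = g by rewrite addrCA mulrNz addNr addr0.
      rewrite -[X in span _ X]eg; apply: spanD; first exact/spanZ/span_head.
      exact/spanW/span_head.
    + by apply: span_mem; rewrite !inE mem_cat w1 !orbT.
    + rewrite inE => /orP [/eqP->|w2]; first exact: span_head.
      by apply: span_mem; rewrite !inE mem_cat w2 !orbT.
  - exists ((g + h *~ q) *~ m + (z1 + z)).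
      apply: spanD; first exact/spanZ/span_head.
      apply: spanW; apply: spanD; first exact: span_cat.
      by apply: span_sub hz => w hw; apply: span_mem; rewrite mem_cat hw orbT.
    rewrite -e ec mulrzDr mulrzA mulrzDl.
    by rewrite !addrA [LHS](ACl (2*4*3*1*5)%AC).
exists (h *~ q + z0); first by exists q; exists z0.
by rewrite ec r00 addr0 mulrzA mulrzDl ez0.
Qed.

(** Induction on the number of generators. If some generating family of this size has a relation,
    take one with least head coefficient; it divides the other coefficients, so the head can be
    corrected to an element that it kills. Otherwise the head is free over the rest. *)
Lemma span_basis s : exists t, (forall v, span t v <-> span s v) /\ indep t.
Proof.
move en: (size s) => n.
elim: n s en => [|n IH] s0 en; first by exists [::]; case: s0 en.
have [[m hm]|norel] := pselect (exists m, has_relation s0 n m).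
  have hex : exists m, `[< has_relation s0 n m >] by exists m; apply/asboolP.
  case: (ex_minnP hex) => {hm}m' /asboolP [m0 [g [s [ss hs [z hz e]]]]] mmin.
  have mmin' k : has_relation s0 n k -> (m' <= k)%N by move=> h; apply/mmin/asboolP.
  have [|z0 hz0 ez] := @min_relation_dvd s0 n m' g [::] s 0 z m0 mmin' ss hs erefl hz.
    by rewrite add0r.
  have g'0 : (g + z0) *~ m' = 0 by rewrite mulrzDl -ez.
  have hs' v : span (g + z0 :: s) v <-> span s0 v.
    rewrite -hs; split; apply: span_sub => w; rewrite inE => /orP [/eqP->|hw].
    - by apply: spanD; [exact: span_head | exact: spanW].
    - exact/spanW/span_mem.
    - rewrite -[X in span _ X](addrK z0); apply: spanD; first exact: span_head.
      exact/spanW/spanN.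
    - exact/spanW/span_mem.
  have [t [ht it]] := IH _ ss.
  exists (g + z0 :: t); split.
    by move=> v; rewrite -hs'; apply: eq_span_cons.
  split=> // k y /ht hy ey.
  have m0' : (m' : int) != 0 by rewrite eqz_nat -lt0n.
  (* The remainder of [k] modulo [m'] is again a head coefficient of a relation, so minimality makes
     it 0. *)
  have ek : (g + z0) *~ k = (g + z0) *~ (k %% m')%Z.
    by rewrite {1}(divz_eq k m') mulrzDr mulrC mulrzA g'0 mul0rz add0r.
  have := modz_ge0 k m0'; have := ltz_pmod k (m0 : 0 < m' :> int).
  case er: (k %% m')%Z => [[|r]|//] rm _; first by rewrite ek er.
  suff : (m' <= r.+1)%N by rewrite leqNgt; move: rm; rewrite ltz_nat => ->.
  apply: mmin'; split=> //; exists (g + z0), s; split=> //.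
  by exists y => //; rewrite -ey ek er.
case: s0 en norel => // g s [ss] norel.
have [t [ht it]] := IH _ ss.
exists (g :: t); split; first exact: eq_span_cons.
split=> // m z /ht hz e.
case: m e => [[|k]|k] e; first by rewrite mulr0z.
  by case: norel; exists k.+1; split=> //; exists g, s; split=> //; exists z.
case: norel; exists k.+1; split=> //; exists g, s; split=> //.
exists (- z); first exact: spanN.
by apply/eqP; rewrite -oppr_eq0 opprD opprK -mulrNz e.
Qed.

(** * Orders of elements and the 2-part of a basis *)

Definition add_order g m : Prop :=
  [/\ (0 < m)%N, g *+ m = 0 & forall k, (0 < k < m)%N -> g *+ k != 0].

Lemma add_orderP g : (forall k, (0 < k)%N -> g *+ k != 0) \/ exists m, add_order g m.
Proof.
have [[k k0 gk]|no] := pselect (exists2 k, (0 < k)%N & g *+ k == 0).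
  right; have hex : exists m, (0 < m)%N && (g *+ m == 0) by exists k; rewrite k0.
  case: (ex_minnP hex) => m /andP [m0 /eqP gm] mmin; exists m; split=> // j /andP [j0 jm].
  by apply/negP => gj; move: (mmin j); rewrite j0 gj leqNgt jm => /(_ isT).
by left=> k k0; apply/negP => gk; apply: no; exists k.
Qed.

Lemma add_order_dvd g m k : add_order g m -> g *+ k = 0 -> (m %| k)%N.
Proof.
move=> [m0 gm min] gk; rewrite /dvdn; apply: contraT => r0.
have := min (k %% m)%N; rewrite lt0n r0 ltn_mod m0 => /(_ isT).
by move: gk; rewrite {1}(divn_eq k m) mulrnDr mulnC mulrnA gm mul0rn add0r => ->; rewrite eqxx.
Qed.

Lemma add_order_mulrn g k m : add_order g (k * m) -> add_order (g *+ k) m.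
Proof.
move=> [km0 gkm min].
move: (km0); rewrite muln_gt0 => /andP [k0 m0].
split=> //; first by rewrite -mulrnA.
move=> j /andP [j0 jm]; rewrite -mulrnA; apply: min.
by rewrite muln_gt0 k0 j0 ltn_pmul2l.
Qed.

Definition odd_or_inf g : Prop :=
  (forall k, (0 < k)%N -> g *+ k != 0) \/ exists2 m, odd m & add_order g m.

(** A generator of even order [2 ^ e * r], [r] odd, splits into parts of orders [2 ^ e] and [r]. Two
    nontrivial 2-parts in a direct sum would contain different involutions, so there is at most one;
    [d = 0] with [h = 0] stands for none. *)
Lemma two_part_basis s :
  (forall u v, u + u = 0 -> v + v = 0 -> u != 0 -> v != 0 -> u = v) -> indep s ->
  exists d t h, [/\ forall v, span (d :: t) v <-> span s v, indep (d :: t),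
    forall g, g \in t -> odd_or_inf g & add_order d (2 ^ h)].
Proof.
move=> uniq_inv; elim: s => [|g s IH].
  move=> _; exists 0, [::], 0%N; split=> //.
  - move=> v; split; first by move=> [m [z /= -> ->]]; rewrite mul0rz addr0.
    by move=> ->; exact: (span0 [:: 0]).
  - by split=> // m z _ _; rewrite mul0rz.
  - by split=> // k /andP [k0]; rewrite expn0 ltnNge k0.
move=> [hg /IH [d [t [h [hs hdt ht od]]]]].
have hgdt : indep (g :: d :: t) by split=> // m z /hs; exact: hg.
have esp v : span (g :: d :: t) v <-> span (g :: s) v by exact: eq_span_cons.
have keep : odd_or_inf g -> exists d t h, [/\ forall v, span (d :: t) v <-> span (g :: s) v,
    indep (d :: t), forall g, g \in t -> odd_or_inf g & add_order d (2 ^ h)].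
  move=> og; exists d, (g :: t), h; split=> //.
  - move=> v; rewrite -esp; apply: eq_mem_span => w; rewrite !inE.
    by rewrite orbCA.
  - exact: indep_swap.
  - by move=> w; rewrite inE => /orP [/eqP->|/ht].
have [ginf|[m om]] := add_orderP g; first by apply: keep; left.
have [modd|meven] := boolP (odd m); first by apply: keep; right; exists m.
have m0 : (0 < m)%N by case: om.
have [e [r [rodd em]]] : exists e r, odd r /\ m = (2 ^ e * r)%N.
  exists (logn 2 m), (m`_2^')%N; split; first by rewrite odd_2'nat part_pnat.
  by rewrite -p_part partnC.
have e0 : (0 < e)%N by case: e em => // em; rewrite em mul1n rodd in meven.
(* If [d] were nontrivial, the involutions of [<g>] and [<d>] would coincide, against
   independence. *)
have d0 : d = 0.
  case: h od => [|h] od; first by case: od => _; rewrite expn0 mulr1n.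
  have om2 : add_order (g *+ m./2) 2.
    by apply: add_order_mulrn; rewrite muln2 halfK (negbTE meven) subn0.
  have od2 : add_order (d *+ 2 ^ h) 2 by apply: add_order_mulrn; rewrite -expnSr.
  have eq : g *+ m./2 = d *+ 2 ^ h.
    by apply: uniq_inv; [case: om2|case: od2|case: om2|case: od2] => // ? ?
      /(_ 1%N isT); rewrite mulr1n.
  have: g *~ (m./2)%:Z = 0.
    apply: (hg _ (- (d *+ 2 ^ h))).
      by apply/hs/spanN; rewrite pmulrn; apply/spanZ/span_head.
    by rewrite -pmulrn eq subrr.
  by rewrite -pmulrn; case: om2 => _ _ /(_ 1%N isT); rewrite mulr1n => /eqP.
have od' : add_order (g *+ r) (2 ^ e) by apply: add_order_mulrn; rewrite mulnC -em.
have og' : add_order (g *+ 2 ^ e) r by apply: add_order_mulrn; rewrite -em.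
have [a [b eab]] : exists a b : int, a * r + b * (2 ^ e)%N = 1.
  have [a [b eab]] := Bezoutz r (2 ^ e)%N.
  exists a, b; rewrite eab /gcdz !absz_nat.
  suff /eqP-> : coprime r (2 ^ e) by [].
  by rewrite coprimeXr // coprime_sym coprime2n.
have eg : (g *+ r) *~ a + (g *+ 2 ^ e) *~ b = g.
  by rewrite !pmulrn -!mulrzA -mulrzDr ![_ * a]mulrC ![_ * b]mulrC eab mulr1z.
exists (g *+ r), (g *+ 2 ^ e :: t), e; split=> //.
- move=> v; rewrite -esp; split; apply: span_sub => w; rewrite !inE.
    case/or3P => [/eqP->|/eqP->|wt].
    + by rewrite pmulrn; apply/spanZ/span_head.
    + by rewrite pmulrn; apply/spanZ/span_head.
    + by apply: span_mem; rewrite !inE wt !orbT.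
  case/or3P => [/eqP->|/eqP->|wt].
  + rewrite -[X in span _ X]eg; apply: spanD; first exact/spanZ/span_head.
    exact/spanW/spanZ/span_head.
  + by rewrite d0; exact: span0.
  + by apply: span_mem; rewrite !inE wt !orbT.
- have hgt := hgdt.1; split; last split; last by case: hdt.
    move=> k z [n [y hy ->]] eq0.
    have : g *~ (r%:Z * k + (2 ^ e)%N%:Z * n) = 0.
      apply: (hgt _ y); first exact: spanW.
      by rewrite mulrzDr !mulrzA -!pmulrn -addrA.
    rewrite mulrzDr !mulrzA -!pmulrn => eq1.
    (* Multiplying by [r] kills the second component; the Bezout relation then leaves
       [(g *+ r) *~ k = 0]. *)
    have eqr : (g *+ r) *~ (k * r) = 0.
      have := congr1 (fun z => z *~ (r%:Z)) eq1.
      rewrite mul0rz mulrzDl -[_ *~ k *~ _]mulrzA -[_ *~ n *~ _]mulrzA.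
      rewrite [n * _]mulrC [_ *~ (_ * n)]mulrzA -[_ *~ r%:Z]pmulrn.
      by case: og' => _ -> _; rewrite mul0rz addr0.
    have -> : k = k * r%:Z * a + (2 ^ e)%N%:Z * (k * b).
      by rewrite -[LHS]mulr1 -eab; ring.
    rewrite mulrzDr mulrzA eqr mul0rz add0r mulrzA -[_ *~ (2 ^ e)%N%:Z]pmulrn.
    by case: od' => _ -> _; rewrite mul0rz.
  move=> n z hz eq0.
  rewrite pmulrn -mulrzA; apply: (hgt _ z); first exact: spanW.
  by rewrite mulrzA -pmulrn.
- move=> w; rewrite inE => /orP [/eqP->|/ht //]; right; by exists r.
Qed.

Lemma odd_or_inf_double g (m : int) : odd_or_inf g -> g *~ (m + m) = 0 -> g *~ m = 0.
Proof.
have natcase n : odd_or_inf g -> g *+ (n + n) = 0 -> g *+ n = 0.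
  move=> [inf|[k kodd ok]] e.
    by case: n e => // n e; have := inf (n.+1 + n.+1)%N isT; rewrite e eqxx.
  have := add_order_dvd ok e; rewrite addnn -mul2n Gauss_dvdr ?coprimen2 // => /dvdnP [c ->].
  by rewrite mulnC mulrnA; case: ok => _ -> _; rewrite mul0rn.
case: m => n og e.
  by rewrite -pmulrn; apply: natcase => //; rewrite pmulrn.
rewrite NegzE mulrNz -pmulrn natcase ?oppr0 //.
apply/eqP; rewrite -oppr_eq0 pmulrn -mulrNz; move: e; rewrite NegzE -opprD => /eqP.
by rewrite PoszD.
Qed.

Lemma span_odd_or_inf_double s v :
  indep s -> (forall g, g \in s -> odd_or_inf g) -> span s v -> v + v = 0 -> v = 0.
Proof.
elim: s v => [|g s IH] v //= [hg hs] og [m [z hz ->]]; rewrite addrACA -mulrzDr => e.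
have e1 : g *~ (m + m) = 0 by apply: hg e; exact: spanD.
rewrite (odd_or_inf_double _ e1) ?add0r; last by apply: og; rewrite mem_head.
apply: IH => //; first by move=> h hh; apply: og; rewrite inE hh orbT.
by move: e; rewrite e1 add0r.
Qed.

(** Independence reduces [v + v = 0] to components: those of odd or infinite order vanish, and a
    cyclic 2-group has at most one involution. *)
Lemma span_double d t h v : indep (d :: t) -> (forall g, g \in t -> odd_or_inf g) ->
  add_order d (2 ^ h) -> span (d :: t) v -> v + v = 0 ->
  v = 0 \/ (0 < h)%N /\ v = d *+ 2 ^ h.-1.
Proof.
move=> [hd it] og od [m [z hz ->]]; rewrite addrACA -mulrzDr => e.
have e1 : d *~ (m + m) = 0 by apply: hd e; exact: spanD.
have -> : z = 0.
  by apply: (span_odd_or_inf_double it og hz); rewrite -e e1 add0r.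
rewrite addr0.
have m0 : (0 : int) < (2 ^ h)%N by rewrite ltz_nat expn_gt0.
have : d *~ (m %% (2 ^ h)%N)%Z = d *~ m.
  rewrite [in RHS](divz_eq m (2 ^ h)%N) [RHS]mulrzDr.
  rewrite [(_ %/ _)%Z * _]mulrC [d *~ (_ * _)]mulrzA -[d *~ (2 ^ h)%N]pmulrn.
  by case: od => _ -> _; rewrite mul0rz add0r.
have := modz_ge0 m (lt0r_neq0 m0); have := ltz_pmod m m0.
case: (m %% _)%Z => // n; rewrite -pmulrn ltz_nat => nlt _ en.
have : (2 ^ h %| n + n)%N.
  by apply: (add_order_dvd od); rewrite mulrnDr en -mulrzDr.
rewrite addnn -mul2n -en.
case: h od nlt {m0 en} => [|h] od nlt hdvd; first by left; case: n nlt hdvd.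
move: hdvd; rewrite expnS dvdn_pmul2l // => /dvdnP [c ec].
rewrite ec; move: nlt; rewrite ec expnS ltn_pmul2r ?expn_gt0 //.
by case: c {ec} => [|[|c]] // _; [left; rewrite mul0n | right; rewrite mul1n].
Qed.

End AdditiveSpan.

(** * Integer powers and subgroups *)

Section IntegerPowers.
Variable gT : groupType.
Implicit Types (x y z g : gT) (i j m : int).

(** A single integer exponent replaces the two natural-number cases of [in_cyclic]. *)
Definition expz x m : gT := match m with Posz n => x ^+ n | Negz n => x ^- n.+1 end.

Lemma expz_nat x (n : nat) : expz x n = x ^+ n. Proof. by []. Qed.

Lemma expz0 x : expz x 0 = 1. Proof. by []. Qed.

Lemma expz1 x : expz x 1 = x. Proof. by []. Qed.

Lemma expzN x m : expz x (- m)%R = (expz x m)^-1.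
Proof. by case: m => [[|n]|n] /=; rewrite ?invg1 ?invgK. Qed.

Lemma expzS x m : expz x (m + 1)%R = expz x m * x.
Proof.
case: m => [n|[|n]]; first by rewrite -PoszD addn1 /= expgSr.
  by rewrite /= mulVg.
have -> : (Negz n.+1 + 1)%R = Negz n by lia.
by rewrite /= [x ^+ n.+2]expgS invgM mulgVK.
Qed.

Lemma expzD x i j : expz x (i + j)%R = expz x i * expz x j.
Proof.
have nat_case (k : int) (n : nat) : expz x (k + n%:Z)%R = expz x k * expz x n.
  elim: n => [|n IH]; first by rewrite addr0 expz0 mulg1.
  by rewrite -addn1 PoszD addrA !expzS IH mulgA.
case: j => n; first exact: nat_case.
have := nat_case (i + Negz n)%R n.+1; rewrite NegzE subrK => ->.
by rewrite expzN mulgK.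
Qed.

Lemma expzM x i j : expz x (i * j)%R = expz (expz x i) j.
Proof.
have nat_case (n : nat) : expz x (i * n%:Z)%R = expz (expz x i) n.
  elim: n => [|n IH]; first by rewrite mulr0.
  by rewrite -addn1 PoszD mulrDr mulr1 expzS expzD IH.
case: j => n; first exact: nat_case.
by rewrite NegzE mulrN !expzN nat_case.
Qed.

Lemma expzJ x g m : expz (x ^ g) m = expz x m ^ g.
Proof. by case: m => n /=; rewrite ?conjVg conjXg. Qed.

Lemma exp1z m : expz (1 : gT) m = 1.
Proof. by case: m => n /=; rewrite expg1n ?invg1. Qed.

Lemma commuteZ x y m : commute x y -> commute x (expz y m).
Proof. by case: m => n /= c; [|apply: commuteV]; apply: commuteX. Qed.

Lemma expMz x y m : commute x y -> expz (x * y) m = expz x m * expz y m.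
Proof.
move=> c; case: m => n /=; rewrite expgMn // invgM.
by apply/esym/commute_sym/commuteV/commute_sym/commuteV/commuteX2.
Qed.

Lemma commuteJ x y : commute x y -> x ^ y = x.
Proof. by move=> c; rewrite conjgE c mulKg. Qed.

Lemma Jcommute x y : x ^ y = x -> commute x y.
Proof. by move=> c; rewrite /commute conjgC c. Qed.

Lemma in_cyclicP x z : in_cyclic x z <-> exists m, z = expz x m.
Proof.
split; first by move=> [n [->|->]]; [exists n | exists (- n%:Z)%R; rewrite expzN].
by move=> [[n|n] ->]; [exists n; left | exists n.+1; right].
Qed.

Lemma infinite_orderZ x m : infinite_order x -> expz x m = 1 -> m = 0.
Proof.
move=> inf; case: m => [[//|n]|n] /= e; first by case: (inf n.+1).
by case: (inf n.+1) => //; apply: invg_inj; rewrite e invg1.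
Qed.

(** * Congruence modulo a subgroup *)

Section Subgroups.
Variable H : gT -> Prop.
Hypothesis sH : is_subgroup H.

Lemma sub1 : H 1. Proof. by case: sH. Qed.
Lemma subM x y : H x -> H y -> H (x * y). Proof. by case: sH => _ [h _]; apply: h. Qed.
Lemma subV x : H x -> H x^-1. Proof. by case: sH => _ [_ h]; apply: h. Qed.
Lemma subX x n : H x -> H (x ^+ n).
Proof. by move=> h; elim: n => [|n IH]; rewrite ?expgS; [exact: sub1 | exact: subM]. Qed.
Lemma subZ x m : H x -> H (expz x m).
Proof. by case: m => n hx /=; [|apply: subV]; apply: subX. Qed.
Lemma subMl x y : H x -> H (x * y) -> H y.
Proof. by move=> hx hxy; rewrite -(mulKg x y); apply: subM => //; apply: subV. Qed.
Lemma subMr x y : H y -> H (x * y) -> H x.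
Proof. by move=> hx hxy; rewrite -(mulgK y x); apply: subM => //; apply: subV. Qed.

(** Equality of the right cosets [H x] and [H y]. *)
Definition eqmod x y := H (x * y^-1).

Lemma eqmod_refl x : eqmod x x. Proof. by rewrite /eqmod mulgV; exact: sub1. Qed.
Lemma eqmod_sym x y : eqmod x y -> eqmod y x.
Proof. by move=> /subV; rewrite invgM invgK. Qed.
Lemma eqmod_trans y x z : eqmod x y -> eqmod y z -> eqmod x z.
Proof. by move=> h1 h2; have := subM h1 h2; rewrite -mulgA mulKg. Qed.
Lemma eqmod1 x : eqmod x 1 <-> H x. Proof. by rewrite /eqmod invg1 mulg1. Qed.
Lemma eqmod_sub x y : eqmod x y -> H x -> H y.
Proof. by move=> /eqmod_sym h hx; have := subM h hx; rewrite mulgVK. Qed.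

Hypothesis nH : normal_in_all H.

Lemma eqmodM x y x' y' : eqmod x y -> eqmod x' y' -> eqmod (x * x') (y * y').
Proof.
rewrite /eqmod => h h'; rewrite invgM.
have -> : x * x' * (y'^-1 * y^-1) = (x' * y'^-1) ^ x^-1 * (x * y^-1).
  by rewrite conjgE invgK !mulgA mulgVK.
by apply: subM => //; apply: nH.
Qed.

Lemma eqmodV x y : eqmod x y -> eqmod x^-1 y^-1.
Proof.
move=> /eqmod_sym h; rewrite /eqmod invgK.
by have := nH x h; rewrite conjgE mulgVK.
Qed.

Lemma eqmodX x y n : eqmod x y -> eqmod (x ^+ n) (y ^+ n).
Proof.
move=> h; elim: n => [|n IH]; first exact: eqmod_refl.
by rewrite !expgS; apply: eqmodM.
Qed.

Lemma eqmodZ x y m : eqmod x y -> eqmod (expz x m) (expz y m).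
Proof. by case: m => n h /=; [|apply: eqmodV]; apply: eqmodX. Qed.

Lemma eqmodJ x y g : eqmod x y -> eqmod (x ^ g) (y ^ g).
Proof. by move=> /(nH g); rewrite /eqmod conjMg conjVg. Qed.

Lemma eqmod_mulr x y : H x -> eqmod (x * y) y.
Proof. by move=> h; rewrite /eqmod mulgK. Qed.

End Subgroups.

Definition capp (H K : gT -> Prop) z := H z /\ K z.

Lemma sub_capp H K : is_subgroup H -> is_subgroup K -> is_subgroup (capp H K).
Proof.
move=> sH sK; split; first by split; apply: sub1.
split; first by move=> x y [? ?] [? ?]; split; apply: subM.
by move=> x [? ?]; split; apply: subV.
Qed.

(** Division with remainder by the least positive element of [P]; [d = 0] covers the zero
    subgroup. *)
Lemma ex_min_int (P : int -> Prop) :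
  P 0%R -> (forall i j, P i -> P j -> P (i + j)%R) -> (forall i, P i -> P (- i)%R) ->
  exists d : nat, P d /\ forall i, P i -> (d %| i)%Z.
Proof.
move=> P0 PD PN.
have PM i (k : int) : P i -> P (i * k)%R.
  move=> Pi; have nat_case (n : nat) : P (i * n%:Z)%R.
    by elim: n => [|n IH]; rewrite ?mulr0 // -addn1 PoszD mulrDr mulr1; apply: PD.
  by case: k => n; rewrite ?NegzE ?mulrN; [|apply: PN]; apply: nat_case.
have [[d [d0 Pd]]|no] := pselect (exists n : nat, (0 < n)%N /\ P n); last first.
  exists 0%N; split=> // -[[//|n]|n] Pi; first by case: no; exists n.+1.
  by case: no; exists n.+1; split=> //; move: (PN _ Pi); rewrite NegzE opprK.
have hex : exists n : nat, (0 < n)%N && `[< P n >].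
  by exists d; rewrite d0; apply/asboolP.
case: (ex_minnP hex) => {d d0 Pd}d /andP [d0 /asboolP Pd] dmin.
exists d; split=> // i Pi; apply/dvdz_mod0P.
have d0' : (0 < d%:Z)%R by rewrite ltz_nat.
have := modz_ge0 i (lt0r_neq0 d0'); have := ltz_pmod i d0'.
have : P (i %% d)%Z by apply: PD => //; apply/PN; rewrite mulrC; apply: PM.
case: (i %% d)%Z => // -[//|r] Pr rd _.
have := dmin r.+1; rewrite /= (introT (asboolP _) Pr) => /(_ isT).
by move: rd; rewrite ltz_nat ltnNge => /negbTE ->.
Qed.

Lemma cyclic_factorP H K : cyclic_factor H K <->
  exists2 y, K y & forall z, K z -> exists m, eqmod H z (expz y m).
Proof.
split=> -[y Ky hy]; exists y => // z /hy.
  by move=> [c /in_cyclicP [m ->] hc]; exists m.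
by move=> [m hm]; exists (expz y m) => //; apply/in_cyclicP; exists m.
Qed.

(** The exponents [m] for which the coset of [y ^ m] meets [capp K C] form a subgroup of the
    integers; an element over its generator generates the new factor. *)
Lemma cyclic_factor_capp H K C :
  is_subgroup H -> normal_in_all H -> is_subgroup K -> is_subgroup C ->
  cyclic_factor H K -> cyclic_factor (capp H C) (capp K C).
Proof.
move=> sH nH sK sC /cyclic_factorP [y Ky hy]; apply/cyclic_factorP.
have [||i|d [[u [Ku Cu] hu] hd]] := @ex_min_int
  (fun m => exists2 u, capp K C u & eqmod H u (expz y m)).
- exists 1; first by split; apply: sub1.
  exact: eqmod_refl.
- move=> i j [u [? ?] hu] [v [? ?] hv]; exists (u * v); first by split; apply: subM.
  by rewrite expzD; apply: eqmodM.
- move=> [u [? ?] hu]; exists u^-1; first by split; apply: subV.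
  by rewrite expzN; apply: eqmodV.
exists u => // z [Kz Cz].
have [m hm] := hy z Kz.
have [|k ek] := dvdzP (hd m _); first by exists z.
exists k; split; last by apply: (subM sC) => //; apply: (subV sC); apply: subZ.
apply: (eqmod_trans sH hm).
by rewrite ek mulrC expzM; apply: (eqmod_sym sH); apply: eqmodZ.
Qed.

End IntegerPowers.

(** * Polycyclic series *)

Section Chains.
Variable gT : groupType.
Implicit Types (x y z g a : gT) (m : int) (S : nat -> gT -> Prop).

(** The terms are indexed by all naturals, the series being constant from [k] on, so that no index
    bound has to be carried. *)
Definition chain S k : Prop :=
  [/\ forall i, is_subgroup (S i) /\ normal_in_all (S i), forall z, S 0 z <-> z = 1,
    forall z, S k z, forall i z, S i z -> S i.+1 z & forall i, cyclic_factor (S i) (S i.+1)].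

Lemma supersoluble_chain : supersoluble gT -> exists S k, chain S k.
Proof.
have sW : is_subgroup (@whole_group gT) by [].
move=> [s [hs h0 hl s0 hf]].
exists (fun i => nth (@whole_group gT) s i), (size s).-1.
have out i : size s <= i -> nth (@whole_group gT) s i = @whole_group gT by apply: nth_default.
split=> //.
- by move=> i; have [/hs|/out ->] := ltnP i (size s).
- by move=> z; rewrite (set_nth_default (@trivial_subgroup gT)) // prednK.
- by move=> i z; have [/hf [h _]|/out ->] := ltnP i.+1 (size s); [apply: h|].
move=> i; have [/hf [_ //]|le] := ltnP i.+1 (size s).
(* From the last term on the factors are trivial, so 1 generates them. *)
rewrite (out _ le); apply/cyclic_factorP; exists 1 => // z _; exists 0%R.
have [lt|/out -> //] := ltnP i (size s).
have ei : i = (size s).-1 by apply/eqP; rewrite eqn_leq -ltnS prednK // lt -ltnS prednK.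
rewrite ei (set_nth_default (@trivial_subgroup gT)) ?prednK //; exact: hl.
Qed.

Lemma no_power_exp0 (N : gT -> Prop) y m : is_subgroup N ->
  (forall n, 0 < n -> ~ N (y ^+ n)) -> N (expz y m) -> m = 0%R.
Proof.
move=> sN no; case: m => [[//|n]|n] /= h; first by case: (no n.+1).
by case: (no n.+1) => //; rewrite -[_ ^+ _]invgK; apply: subV.
Qed.

(** Induction along the series. If the top factor is finite, [r]-th powers descend to the term
    below. If it is infinite and [b] has exponent [m] in it, the degree of a root of [b] divides
    [m]; for [m = 0] the roots already lie below. *)
Lemma bounded_roots S k a : chain S k -> infinite_order a ->
  exists K, forall n x, K < n -> x ^+ n <> a.
Proof.
move=> [sS S0 Sk Smono Sf].
suff main i b : S i b -> infinite_order b ->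
    exists K, forall n x, K < n -> S i x -> x ^+ n <> b.
  by move=> /(main k a (Sk a)) [K hK]; exists K => n x Kn; apply: hK.
elim: i b => [|i IH] b; first by move=> /S0 -> /(_ 1%N isT).
move=> Sb inf; have [sN nN] := sS i; have /cyclic_factorP [y _ hy] := Sf i.
have [[r [r0 yr]]|no] := pselect (exists r, 0 < r /\ S i (y ^+ r)).
  have Sr z : S i.+1 z -> S i (z ^+ r).
    move=> /hy [m hm]; apply: (eqmod_sub sN (eqmod_sym sN (eqmodX sN nN r hm))).
    by rewrite -!expz_nat -expzM mulrC expzM; apply: subZ.
  have [|K hK] := IH (b ^+ r) (Sr _ Sb).
    by move=> n n0; rewrite -expgnA; apply: inf; rewrite muln_gt0 r0.
  exists K => n x Kn /Sr xr e; apply: (hK n (x ^+ r)) => //.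
  by rewrite expgnAC e.
have {}no n : 0 < n -> ~ S i (y ^+ n) by move=> n0 h; apply: no; exists n.
have [m hm] := hy b Sb.
have key n x l : x ^+ n = b -> eqmod (S i) x (expz y l) -> (l * n%:Z = m)%R.
  move=> e hl; apply/eqP; rewrite -subr_eq0; apply/eqP; apply: (no_power_exp0 sN no).
  rewrite expzD expzN.
  apply: (eqmod_trans sN (y := b)) => //; apply: (eqmod_sym sN).
  by rewrite -e expzM expz_nat; apply: eqmodX.
have [m0|m0] := eqVneq m 0%R.
  have Sib : S i b by apply/eqmod1; rewrite m0 in hm.
  have [K hK] := IH b Sib inf.
  exists K => n x Kn /hy [l hl] e; apply: (hK n x) => //.
  have := key n x l e hl; rewrite m0 => /eqP; rewrite mulf_eq0.
  case/orP=> /eqP; last by move=> n0; move: Kn; have -> : n = 0%N by lia.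
  by move=> l0; apply/eqmod1; rewrite l0 in hl.
exists `|m|%N => n x Kn /hy [l hl] e.
have := key n x l e hl => em; move: Kn; rewrite -em abszM absz_nat ltnNge => /negP; apply.
by apply: leq_pmull; rewrite absz_gt0; apply: contra_neq m0 => l0; rewrite -em l0 mul0r.
Qed.

(** * Finite normal subgroups and a normal infinite cyclic subgroup *)

Definition finite_subset (N : gT -> Prop) := exists s : seq gT, forall z, N z -> z \in s.

Lemma finite_pigeonhole (N : gT -> Prop) (f : nat -> gT) :
  finite_subset N -> (forall n, N (f n)) -> exists i j, i < j /\ f i = f j.
Proof.
move=> [s hs] hf; set t := [seq f i | i <- iota 0 (size s).+1].
have : ~~ uniq t.
  apply/negP => ut; have : size t <= size s.
    by apply: uniq_leq_size ut _ => w /mapP [i _ ->]; apply: hs.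
  by rewrite size_map size_iota ltnn.
move=> /(uniqPn 1) [i [j [ij]]]; rewrite size_map size_iota => js.
rewrite !(nth_map 0) ?size_iota //; last exact: ltn_trans js.
rewrite !nth_iota //; last exact: ltn_trans js.
by move=> e; exists i, j.
Qed.

(** The product of the individual [t] over a list covering [N] serves all elements at once. *)
Lemma uniform_multiple (N : gT -> Prop) (Q : gT -> nat -> Prop) : finite_subset N ->
  (forall z, N z -> exists2 t, 0 < t & Q z t) ->
  (forall z t u, Q z t -> Q z (t * u)%N) ->
  exists2 t, 0 < t & forall z, N z -> Q z t.
Proof.
move=> [s hs] ex mul.
suff [t t0 ht] : exists2 t, 0 < t & forall z, z \in s -> N z -> Q z t.
  by exists t => // z Nz; apply: ht => //; apply: hs.
elim: s {hs} => [|w s [t t0 ht]]; first by exists 1%N.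
have [/ex [u u0 hu]|nN] := pselect (N w).
  exists (u * t)%N; first by rewrite muln_gt0 u0.
  move=> z; rewrite inE => /orP [/eqP-> _|zs Nz]; first exact: mul.
  by rewrite mulnC; apply/mul/ht.
exists t => // z; rewrite inE => /orP [/eqP->|]; [by []|exact: ht].
Qed.

Lemma finite_exponent (N : gT -> Prop) : is_subgroup N -> finite_subset N ->
  exists2 q, 0 < q & forall z, N z -> z ^+ q = 1.
Proof.
move=> sN fN; apply: uniform_multiple => //; last first.
  by move=> z t u e; rewrite expgnA e expg1n.
move=> z Nz; have [|i [j [ij e]]] := finite_pigeonhole (f := fun n => z ^+ n) fN.
  by move=> n; apply: subX.
by exists (j - i); rewrite ?subn_gt0 // expgnFr ?e ?mulgV // ltnW.
Qed.

Lemma conj_cycle z y i j : i <= j -> z ^ (y ^+ i) = z ^ (y ^+ j) -> commute z (y ^+ (j - i)).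
Proof.
move=> ij e; apply: Jcommute; apply: (@conjg_inj _ (y ^+ i)).
by rewrite -conjgM -expgnDr subnK.
Qed.

(** The conjugates of [z] by powers of [y] stay in the finite set [N], so two of them coincide. *)
Lemma finite_centralizing_power (N : gT -> Prop) y :
  normal_in_all N -> finite_subset N ->
  exists2 t, 0 < t & forall z, N z -> commute z (y ^+ t).
Proof.
move=> nN fN; apply: uniform_multiple => //; last first.
  by move=> z t u c; rewrite expgnA; apply: commuteX.
move=> z Nz; have [|i [j [ij e]]] := finite_pigeonhole (f := fun n => z ^ (y ^+ n)) fN.
  by move=> n; apply: nN.
by exists (j - i); [rewrite subn_gt0 | apply: conj_cycle => //; apply: ltnW].
Qed.

(** Let [y] generate the first infinite factor, over a finite term [N]. Each conjugate of [y] is [y]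
    or its inverse modulo [N]. Passing to a power [y ^+ t] that centralizes [N], and then to its
    [q]-th power with [q] killing [N], turns these congruences into equalities. *)
Lemma exists_normal_infinite_cyclic S k : chain S k -> infinite_group gT ->
  exists a, infinite_order a /\ forall g, a ^ g = a \/ a ^ g = a^-1.
Proof.
move=> [sS S0 Sk Smono Sf] inf.
have [i [fi nfi]] : exists i, finite_subset (S i) /\ ~ finite_subset (S i.+1).
  apply: contrapT => no; apply: inf.
  suff [s hs] : finite_subset (S k) by exists s => x; apply/hs/Sk.
  elim: k {Sk} => [|k IH]; first by exists [:: 1] => z /S0 ->; rewrite inE.
  by apply: contrapT => nf; apply: no; exists k.
have [sN nN] := sS i; have /cyclic_factorP [y Sy hy] := Sf i.
(* Otherwise [S i.+1] would be covered by [n] cosets of the finite [S i]. *)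
have nopow n : 0 < n -> ~ S i (y ^+ n).
  move=> n0 Syn; apply: nfi; have [s hs] := fi.
  exists [seq h * y ^+ j | h <- s, j <- iota 0 n] => z /hy [m hm].
  have n0' : (0 < n%:Z)%R by rewrite ltz_nat.
  have := modz_ge0 m (lt0r_neq0 n0'); have := ltz_pmod m n0'.
  case er: (m %% n)%Z => [r|//] rn _.
  have hz : eqmod (S i) z (y ^+ r).
    apply: (eqmod_trans sN hm); rewrite (divz_eq m n) er expzD mulrC expzM.
    by apply: eqmod_mulr => //; apply: subZ.
  apply/allpairsP; exists (z * (y ^+ r)^-1, r); split=> /=.
  - exact: hs.
  - by rewrite mem_iota add0n; move: rn; rewrite ltz_nat.
  - by rewrite mulgVK.
have nopowz m : S i (expz y m) -> m = 0%R by apply: no_power_exp0.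
have [q q0 hq] := finite_exponent sN fi.
have [t t0 ht] := finite_centralizing_power y nN fi.
(* The exponents for [g] and [g^-1] multiply to 1, so they are units of the integers. *)
have conj_unit g : exists2 m, eqmod (S i) (y ^ g) (expz y m) & m = 1%R \/ m = (-1)%R.
  have nS := (sS i.+1).2.
  have [m hm] := hy _ (nS _ g Sy); have [m' hm'] := hy _ (nS _ g^-1 Sy).
  exists m => //.
  have h : eqmod (S i) y (expz y (m * m')%R).
    rewrite expzM -{1}(conjgKV g y); apply: (eqmod_trans sN (eqmodJ nN g hm')).
    by rewrite -expzJ; apply: eqmodZ.
  have /eqP : (1 - m * m')%R = 0%R by apply: nopowz; rewrite expzD expzN.
  rewrite subr_eq0 => /eqP /(congr1 absz) /esym /eqP.
  by rewrite abszM muln_eq1 => /andP [/eqP m1 _]; lia.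
exists ((y ^+ t) ^+ q); split.
  move=> n n0 e; apply: (nopow (t * q * n)%N); first by rewrite !muln_gt0 t0 q0.
  by rewrite !expgnA e; apply: sub1.
move=> g; have [m hm um] := conj_unit g.
suff -> : (y ^+ t) ^+ q ^ g = expz ((y ^+ t) ^+ q) m.
  by case: um => ->; [left | right].
rewrite !conjXg; set w := expz (y ^+ t) m.
have hn : S i ((y ^ g) ^+ t * w^-1).
  rewrite /w -expz_nat -!expz_nat -expzM mulrC expzM; exact: eqmodZ.
have -> : (y ^ g) ^+ t = ((y ^ g) ^+ t * w^-1) * w by rewrite mulgVK.
rewrite expgMn; last by apply/commuteZ/ht.
by rewrite (hq _ hn) mul1g /w -[LHS]expz_nat -expzM mulrC expzM.
Qed.

End Chains.

(** * The centralizer of a normal infinite cyclic subgroup *)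

Section AbelianCentralizer.
Variable gT : groupType.
Implicit Types (x y z g a b f : gT) (m : int) (S : nat -> gT -> Prop).

Definition centralizer (B : gT -> Prop) z := forall h, B h -> commute z h.

Lemma sub_centralizer B : is_subgroup (centralizer B).
Proof.
split; first by move=> h _; apply/commute_sym/commute1.
split=> [x y hx hy h Bh|x hx h Bh]; apply: commute_sym.
  by apply: commuteM; apply: commute_sym; [apply: hx | apply: hy].
by apply/commuteV/commute_sym/hx.
Qed.

(** As [y ^+ M] fixes [b], conjugation by [y ^+ (1 + M * l)] acts on [b] as [y] does. *)
Lemma commute_power_conj b y f M l : b ^ y = b * f -> commute b f -> commute b (y ^+ M) ->
  commute (b ^+ (1 + M * l)%N) (y ^+ (1 + M * l)%N) -> f ^+ (1 + M * l)%N = 1.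
Proof.
move=> eby cbf cM; set k := (1 + M * l)%N => /commuteJ; rewrite conjXg.
have -> : b ^ (y ^+ k) = b * f.
  rewrite /k addnC expgnDr conjgM expgnA (commuteJ (commuteX l cM)) expg1.
  exact: eby.
by rewrite expgMn // -{2}[b ^+ k]mulg1 => /mulgI.
Qed.

(** Write [k = 1 + M * l]. If [f ^+ q = 1], some positive power of [y] fixes [b], and [M] is chosen
    divisible by [q] too, so that [f ^+ k = f]. If [f] has infinite order, either [y] centralizes
    [f] and the commutator of [b ^+ k] and [y ^+ k] is [f ^+ (k * k)], or [y] inverts [f] and
    [y ^+ 2] fixes [b]. *)
Lemma noncommuting_powers b y f e : b ^ y = b * f -> commute b f -> f <> 1 ->
  f ^ y = expz f e -> (infinite_order f -> e = 1%R \/ e = (-1)%R) ->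
  exists2 M, 0 < M & forall l, ~ commute (b ^+ (1 + M * l)%N) (y ^+ (1 + M * l)%N).
Proof.
move=> eby cbf f1 efy einf.
have [[q [q0 fq]]|finf] := pselect (exists q, 0 < q /\ f ^+ q = 1).
  (* This finite coset of [<f>] contains all conjugates of [b] by powers of [y]. *)
  pose N z := exists m, z = b * expz f m.
  have fN : finite_subset N.
    exists [seq b * f ^+ j | j <- iota 0 q] => z [m ->].
    have q0' : (0 < q%:Z)%R by rewrite ltz_nat.
    have := modz_ge0 m (lt0r_neq0 q0'); have := ltz_pmod m q0'.
    case er: (m %% q)%Z => [r|//] rq _; apply/mapP; exists r.
      by rewrite mem_iota add0n; move: rq; rewrite ltz_nat.
    by rewrite (divz_eq m q) er expzD mulrC expzM expz_nat fq exp1z mul1g.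
  have [t|i [j [ij eij]]] := finite_pigeonhole (f := fun t => b ^ (y ^+ t)) fN.
    elim: t => [|t [m em]]; first by exists 0%R; rewrite conjg1 mulg1.
    exists (1 + e * m)%R; rewrite expgSr conjgM em conjMg eby -expzJ efy -expzM.
    by rewrite expzD mulgA.
  exists ((j - i) * q)%N; first by rewrite muln_gt0 subn_gt0 ij q0.
  move=> l c; apply: f1.
  have cM : commute b (y ^+ ((j - i) * q)%N).
    by rewrite expgnA; apply: commuteX; apply: conj_cycle => //; apply: ltnW.
  have := commute_power_conj eby cbf cM c.
  have -> : ((j - i) * q * l = q * ((j - i) * l))%N by rewrite mulnAC mulnC.
  by rewrite expgnDr expgnA fq expg1n mulg1.
have {}finf : infinite_order f by move=> n n0 e0; apply: finf; exists n.
case: (einf finf) => ee; rewrite {}ee ?expz1 ?expzN in efy.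
  exists 1%N => // l /commuteJ; rewrite mul1n; set k := (1 + l)%N; rewrite conjXg.
  have eb n : b ^ (y ^+ n) = b * f ^+ n.
    elim: n => [|n IH]; first by rewrite conjg1 mulg1.
    by rewrite expgSr conjgM IH conjMg eby conjXg efy -mulgA -expgS.
  rewrite eb expgMn; last exact: commuteX.
  rewrite -{2}[b ^+ k]mulg1 -expgnA => /mulgI; apply: finf.
  by rewrite /k muln_gt0.
exists 2 => // l /(commute_power_conj eby cbf _) h; apply: (finf (1 + 2 * l)%N) => //.
by apply: h; apply: Jcommute; rewrite expg2 conjgM eby conjMg efy eby mulgK.
Qed.

Lemma abelian_centralizer S k0 a : chain S k0 ->
  (forall H : gT -> Prop, is_subgroup H -> nonabelian H -> centralizer_le H) ->
  infinite_order a -> forall u v, commute u a -> commute v a -> commute u v.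
Proof.
move=> chS self_cent inf u v cu cv; have [sS S0 Sk Smono Sf] := chS.
pose C z := commute z a.
have sC : is_subgroup C.
  split; first exact/commute_sym/commute1.
  split=> [x y hx hy|x hx]; apply: commute_sym; last exact/commuteV/commute_sym.
  by apply: commuteM; apply: commute_sym.
pose Ci i := capp (S i) C.
have sCi i : is_subgroup (Ci i) by apply: sub_capp => //; apply: (sS i).1.
have fCi i : cyclic_factor (Ci i) (Ci i.+1).
  by apply: cyclic_factor_capp => //; apply: (sS _).1 || apply: (sS _).2.
have CiJ i z g : Ci i z -> C g -> Ci i (z ^ g).
  move=> [Sz Cz] Cg; split; first exact: (sS i).2.
  by rewrite /C conjgE; apply: (subM sC); [apply: subV | apply: subM].
have Cimono i j z : i <= j -> Ci i z -> Ci j z.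
  by move=> /subnK <-; elim: (j - i) => // n IH /IH [? ?]; split=> //; apply: Smono.
pose ab i := forall x y, Ci i x -> Ci i y -> commute x y.
apply: contrapT => nuv.
(* [Ci i] is the abelian normal subgroup [B] of [C], and [y] will generate the next, nonabelian term
   over it. *)
have [i [abi nabi]] : exists i, ab i /\ ~ ab i.+1.
  apply: contrapT => no; apply: nuv.
  suff h : ab k0 by apply: h; split=> //; apply: Sk.
  elim: k0 {chS Sk} => [|k IH]; first by move=> x y [/S0 -> _] _; apply/commute_sym/commute1.
  by apply: contrapT => nab; apply: no; exists k.
have /cyclic_factorP [y Ciy hy] := fCi i.
have factor_commute j z g : centralizer (Ci j) g -> commute g z ->
    (forall w, Ci j.+1 w -> exists m, eqmod (Ci j) w (expz z m)) -> centralizer (Ci j.+1) g.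
  move=> hg cgz hz w /hz [m hm]; rewrite -(mulgVK (expz z m) w).
  by apply: commuteM; [apply: hg | apply: commuteZ].
have ny : ~ centralizer (Ci i) y.
  move=> cy; apply: nabi => x z hx hz.
  apply: (factor_commute i y x _ _ hy z hz).
    move=> h Cih; apply/commute_sym/(factor_commute i y h _ _ hy x hx).
      by move=> w; apply: abi.
    exact/commute_sym/cy.
  exact/commute_sym/(factor_commute i y y cy _ hy x hx).
(* Below [B], locate the factor at which [y] stops centralizing the series; [b] is its generator. *)
have [j [ji [cj ncj]]] : exists j, j < i /\ (centralizer (Ci j) y /\ ~ centralizer (Ci j.+1) y).
  have : forall n, n <= i -> ~ centralizer (Ci n) y ->
     exists j, j < i /\ (centralizer (Ci j) y /\ ~ centralizer (Ci j.+1) y).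
    elim=> [_ []|n IH ni nc]; first by move=> h [/S0 -> _]; apply: commute1.
    have [c|] := pselect (centralizer (Ci n) y); first by exists n.
    by apply: IH; apply: ltnW.
  by move/(_ i (leqnn i) ny).
have /cyclic_factorP [b Cjb hb] := fCi j.
have nyb : ~ commute y b by move=> c; apply/ncj/(factor_commute j b y cj c hb).
have Cib : Ci i b by apply: Cimono Cjb.
have Cy := Ciy.2.
have Ciby : Ci i (b ^ y) by apply: CiJ.
pose f := b^-1 * b ^ y.
have Cif : Ci i f by apply: (subM (sCi i)) => //; apply: subV.
have eby : b ^ y = b * f by rewrite /f mulVKg.
have f1 : f <> 1 by move=> f1; apply/nyb/commute_sym/Jcommute; rewrite eby f1 mulg1.
have cbf : commute b f by apply: abi.
have [e he] := hb _ (CiJ j.+1 b y Cjb Cy).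
(* Conjugate [f = b^-1 * c * b ^ e] by [y], which fixes [c] and sends [b] to [b * f]. *)
have efy : f ^ y = expz f e.
  have [c [Cjc ec]] : exists c, Ci j c /\ b ^ y = c * expz b e.
    by exists (b ^ y * (expz b e)^-1); rewrite mulgVK.
  have Cic : Ci i c by apply: Cimono Cjc; apply: ltnW.
  rewrite {1}/f {1}ec !conjMg conjVg (commuteJ (commute_sym (cj c Cjc))) -expzJ eby expMz //.
  by rewrite (mulgA c) -ec eby mulKg.
(* No positive power [b ^+ n] lies in [Ci j], since [y] multiplies it by [f ^+ n]. Hence the
   exponents of [y] and [y^-1] on [b] modulo [Ci j] multiply to 1. *)
have einf : infinite_order f -> e = 1%R \/ e = (-1)%R.
  move=> finf.
  have nob n : 0 < n -> ~ Ci j (b ^+ n).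
    move=> n0 /cj /commute_sym/commuteJ; rewrite conjXg eby expgMn //.
    by rewrite -{2}[b ^+ n]mulg1 => /mulgI; apply: finf.
  have [e' he'] := hb _ (CiJ j.+1 b y^-1 Cjb (subV sC Cy)).
  have h : eqmod (Ci j) b (expz b (e * e')%R).
    have : eqmod (Ci j) ((b ^ y^-1) ^ y) (expz b e' ^ y).
      by rewrite /eqmod -conjVg -conjMg; apply: CiJ.
    rewrite conjgKV -expzJ => h1; apply: (eqmod_trans (sCi j) h1).
    have [sj nj] := sS j.
    rewrite expzM; split; last first.
      apply: (subM sC); first by apply: (subZ sC); exact: Ciby.2.
      by apply: (subV sC); do 2!apply: (subZ sC); exact: Cib.2.
    by apply: (@eqmodZ _ (S j)) => //; case: he.
  have /eqP : (1 - e * e')%R = 0%R.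
    by apply: (no_power_exp0 (sCi j) nob); rewrite expzD expzN.
  rewrite subr_eq0 => /eqP /(congr1 absz) /esym /eqP.
  by rewrite abszM muln_eq1 => /andP [/eqP e1 _]; lia.
have [M M0 hM] := noncommuting_powers eby cbf f1 efy einf.
have [K hK] := bounded_roots chS inf.
have sN := sub_centralizer (Ci i).
(* If [y ^+ s] centralizes [Ci i], exponents count only modulo [s]; if no positive power does, [m]
   must be 0 and [s = 1] will do. *)
have [s [s0 hs]] : exists s, 0 < s /\ forall m n,
    centralizer (Ci i) (expz y (m * (1 + s * n)%N%:Z)%R) ->
    centralizer (Ci i) (expz y m).
  have [[s [s0 hs]]|no] := pselect (exists s, 0 < s /\ centralizer (Ci i) (y ^+ s)).
    exists s; split=> // m n h.
    apply: (subMr sN (y := expz y (m * (s * n)%N%:Z)%R)).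
      by rewrite PoszM mulrCA expzM; apply: (subZ sN).
    by move: h; rewrite PoszD mulrDr mulr1 expzD.
  exists 1%N; split=> // m n h.
  have : (m * (1 + 1 * n)%N%:Z)%R = 0%R.
    by apply: (no_power_exp0 sN _ h) => r r0 hr; apply: no; exists r.
  by move=> /eqP; rewrite mulf_eq0 orbF => /eqP ->; apply: sub1.
(* [k] is 1 modulo [M], so [b ^+ k] and [y ^+ k] do not commute; 1 modulo [s], so it can be
   cancelled through [hs]; and above [K], so [a] has no [k]-th root. *)
pose k := (1 + M * (s * K.+1))%N.
have kK : K < k.
  by rewrite /k add1n ltnS mulnA; apply: leq_trans (leq_pmull _ _); rewrite ?muln_gt0 ?M0.
(* The group [B^k <y^k>]: closed under products because [B] is abelian and normalized by [y]. *)
pose H z := exists h m, Ci i h /\ z = h ^+ k * expz y (m * k%:Z)%R.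
have sH : is_subgroup H.
  split; first by exists 1, 0%R; split; [exact: sub1 | rewrite expg1n mul0r mulg1].
  split=> [x z [h [m [Ch ->]]] [h' [m' [Ch' ->]]]|x [h [m [Ch ->]]]].
    set g := expz y (m * k)%R.
    have Ch'' : Ci i (h' ^ g^-1) by apply: CiJ => //; apply/(subV sC)/(subZ sC).
    exists (h * h' ^ g^-1), (m + m')%R; split; first exact: subM.
    rewrite expgMn; last exact: abi.
    rewrite mulrDl expzD -/g -conjXg !mulgA; congr (_ * _).
    by rewrite invgK mulgVK.
  exists (h^-1 ^ expz y (m * k)%R), (- m)%R; split.
    by apply: CiJ; [apply: subV | apply: subZ].
  by rewrite mulNr expzN -conjXg expVgn conjgE !mulgA mulgK invgM.
have Ha : H a.
  apply: (self_cent H) => //.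
    exists (b ^+ k), (y ^+ k); split; [|split].
    - by exists b, 0%R; rewrite mul0r mulg1.
    - by exists 1, 1%R; split; [exact: sub1 | rewrite expg1n mul1g mul1r].
    - exact: hM.
  move=> z [h [m [Ch ->]]]; apply: commuteM.
    by apply/commuteX/commute_sym/Ch.2.
  by apply/commuteZ/commute_sym.
have [h [m [Ch ea]]] := Ha.
(* [a] and [h ^+ k] centralize [Ci i], hence so does the remaining factor of [a]. Then [h] and
   [y ^ m] commute, and [a] is the [k]-th power of their product. *)
have cym : centralizer (Ci i) (expz y m).
  apply: (hs _ (M * K.+1)%N); rewrite mulnCA -/k.
  apply: (subMl sN (x := h ^+ k)); first by apply: (subX sN) => w; apply: abi.
  by rewrite -ea => w [_]; apply: commute_sym.
apply: (hK k (h * expz y m) kK).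
by rewrite expgMn; [rewrite ea expzM | apply/commute_sym/cym].
Qed.

End AbelianCentralizer.

(** * Elements inverting a normal infinite cyclic subgroup *)

Section InvertingElement.
Variable gT : groupType.
Implicit Types (x y z g b : gT) (m : int).

Lemma expz_order x N m : has_order x N -> expz x m = 1 -> (N %| m)%Z.
Proof.
move=> [N0 [eN hN]] e; apply/dvdz_mod0P.
have N0' : (0 < N%:Z)%R by rewrite ltz_nat.
have := modz_ge0 m (lt0r_neq0 N0'); have := ltz_pmod m N0'.
have : expz x (m %% N)%Z = 1.
  by rewrite expzD e mul1g mulrC -mulrN expzM /= eN exp1z.
case: (m %% N)%Z => // -[//|r] er rN _; by case: (hN r.+1).
Qed.

Lemma has_order_ex x n : 0 < n -> x ^+ n = 1 -> exists N, has_order x N.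
Proof.
move=> n0 e; have hex : exists n, (0 < n) && (x ^+ n == 1) by exists n; rewrite n0 e eqxx.
case: (ex_minnP hex) => N /andP [N0 /eqP eN] min.
exists N; split=> //; split=> // k /andP [k0 kN] ek.
by have := min k; rewrite k0 ek eqxx leqNgt kN => /(_ isT).
Qed.

Variable a : gT.
Hypothesis self_cent :
  forall H : gT -> Prop, is_subgroup H -> nonabelian H -> centralizer_le H.
Hypothesis inf_a : infinite_order a.
Hypothesis conj_a : forall g, a ^ g = a \/ a ^ g = a^-1.
Hypothesis abC : forall u v, commute u a -> commute v a -> commute u v.

Let central z := forall g, commute z g.

Lemma inverting_not_commute g : a ^ g = a^-1 -> ~ commute g a.
Proof.
move=> eg /commute_sym/commuteJ; rewrite eg => e.
by case: (inf_a (k := 2)) => //; rewrite expg2 -{1}e mulVg.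
Qed.

Lemma commute_or_invert g : commute g a \/ a ^ g = a^-1.
Proof. by case: (conj_a g) => e; [left; apply/commute_sym/Jcommute | right]. Qed.

Lemma sub_Ca : is_subgroup (fun z => commute z a).
Proof.
split; first exact/commute_sym/commute1.
split=> [x y hx hy|x hx]; apply: commute_sym; last exact/commuteV/commute_sym.
by apply: commuteM; apply: commute_sym.
Qed.

Lemma inverting_div g h : a ^ g = a^-1 -> a ^ h = a^-1 -> commute (h * g^-1) a.
Proof.
move=> eg eh; apply/commute_sym/Jcommute.
by rewrite conjgM eh -eg conjgK.
Qed.

(** The group is the union of [C(a)] and [C(a) g], and [C(a)] is abelian. *)
Lemma centralI g z : a ^ g = a^-1 -> commute z a -> commute z g -> central z.
Proof.
move=> eg za zg h; case: (commute_or_invert h) => [ha|eh]; first exact: abC.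
rewrite -(mulgVK g h); apply: commuteM => //.
by apply: abC => //; apply: inverting_div.
Qed.

Lemma sqr_central g : a ^ g = a^-1 -> central (g * g).
Proof.
move=> eg; apply: (centralI eg).
  by apply/commute_sym/Jcommute; rewrite conjgM eg conjVg eg invgK.
exact/commute_sym/commuteM.
Qed.

Lemma expz_double x m : expz x (m + m)%R = expz (x * x) m.
Proof. by rewrite expMz // expzD. Qed.

Lemma odd_power_inverts g m : a ^ g = a^-1 -> a ^ expz g (m + m + 1)%R = a^-1.
Proof.
move=> eg; rewrite expzD expz_double conjgM expz1 (_ : a ^ expz (g * g) m = a) //.
exact/commuteJ/commuteZ/commute_sym/sqr_central.
Qed.

Lemma expz_swap h m : exists m', h * expz a m = expz a m' * h.
Proof.
rewrite conjgCV -expzJ; case: (conj_a h^-1) => ->; first by exists m.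
by exists (- m)%R; rewrite -mulN1r expzM.
Qed.

Lemma int_parity m : exists q, m = (q + q)%R \/ m = (q + q + 1)%R.
Proof. by exists (m %/ 2)%Z; lia. Qed.

(* [<a> <g ^ r>] is nonabelian, hence contains the centre. *)
Lemma central_odd_power g (r : nat) z : odd r -> a ^ g = a^-1 -> central z ->
  exists m, z = expz (g * g) (r%:Z * m)%R.
Proof.
move=> odd_r eg cz.
pose H w := exists i j, w = expz a i * expz g (r%:Z * j)%R.
have sH : is_subgroup H.
  split; first by exists 0%R, 0%R; rewrite mulr0 mulg1.
  split=> [u v [i [j ->]] [i' [j' ->]]|u [i [j ->]]].
    have [k ek] := expz_swap (expz g (r%:Z * j)%R) i'.
    exists (i + k)%R, (j + j')%R.
    by rewrite mulrDr !expzD -!mulgA; congr (_ * _); rewrite !mulgA ek.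
  have [k ek] := expz_swap (expz g (r%:Z * - j)%R) (- i)%R.
  by exists k, (- j)%R; rewrite -ek mulrN !expzN invgM.
have [q er] : exists q, (r%:Z = q + q + 1)%R by exists (Posz r./2); lia.
have [i [j ez]] : H z.
  apply: (self_cent sH); last by move=> w _; apply: cz.
  exists a, (expz g r); split; first by exists 1%R, 0%R; rewrite mulr0 expz1 mulg1.
  split; first by exists 0%R, 1%R; rewrite mulr1 mul1g.
  move=> /commute_sym; apply: inverting_not_commute.
  by rewrite er odd_power_inverts.
(* With an odd exponent of [g], the central element [z] would invert [a]. *)
have [t ej] : exists t, (r%:Z * j)%R = (t + t)%R /\ exists s, t = (r%:Z * s)%R.
  have [s [ej|ej]] := int_parity j.
    by exists (r%:Z * s)%R; split; [rewrite ej mulrDr | exists s].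
  exfalso; apply: (inverting_not_commute (g := z)); last exact: cz.
  rewrite ez conjgM (commuteJ (commuteZ _ (commute_refl a))).
  have -> : (r%:Z * j)%R = (((q + q + 1) * s + q) + ((q + q + 1) * s + q) + 1)%R.
    by rewrite er ej; ring.
  exact: odd_power_inverts.
case: ej => ej [s es]; rewrite ej expz_double in ez.
(* [g] commutes with [a ^ i] but also inverts it, so [i + i = 0]. *)
suff i0 : i = 0%R by exists s; rewrite ez i0 mul1g es.
have : commute (expz a i) g.
  have -> : expz a i = z * expz (g * g) (- t)%R by rewrite ez expzN mulgK.
  by apply/commute_sym/commuteM; [apply/commute_sym/cz | apply/commuteZ/commute_sym/sqr_central].
move=> /commuteJ; rewrite -expzJ eg -[a^-1]/(expz a (- 1)%R) -expzM mulN1r => e.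
have : (i + i)%R = 0%R by apply: (infinite_orderZ inf_a); rewrite expzD -{1}e expzN mulVg.
by lia.
Qed.

(** Taking [r = 3] gives [x ^ (6 m - 2) = 1] with a nonzero exponent, so the order is finite. Write
    it as [c r] with [c] a power of 2 and [r] odd; the same property for [r] gives [x ^ (2 c) = 1],
    so [r] divides 2. *)
Lemma inverting_order x : a ^ x = a^-1 -> exists n, has_order x (2 ^ n)%N.
Proof.
move=> ex.
have power r : odd r -> exists m, x * x = expz (x * x) (r%:Z * m)%R.
  by move=> odd_r; apply: central_odd_power => //; apply: sqr_central.
have [N oN] : exists N, has_order x N.
  have [m] := power 3 isT; rewrite -expz_double => em.
  pose d := (3%:Z * m + 3%:Z * m - 2)%R.
  have ed : expz x d = 1 by rewrite /d expzD -em expzN -[expz x 2]/(x * x) mulgV.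
  have d0 : d <> 0%R by rewrite /d; lia.
  apply: (has_order_ex (n := `|d|%N)); first by rewrite absz_gt0; apply/eqP.
  case: d ed {d0} => n //= /(congr1 (fun z => z^-1)).
  by rewrite invgK invg1.
have N0 : 0 < N by case: oN.
have oddr : odd (N`_2^')%N by rewrite odd_2'nat part_pnat.
have eN : N = (2 ^ logn 2 N * N`_2^')%N by rewrite -p_part partnC.
exists (logn 2 N); suff r1 : (N`_2^' = 1)%N by rewrite r1 muln1 in eN; rewrite -eN.
move: (N`_2^')%N oddr eN => r oddr eN; set c := (2 ^ logn 2 N)%N in eN.
have [m em] := power r oddr.
have c0 : 0 < c by rewrite expn_gt0.
have : (N %| (c + c)%N%:Z)%Z.
  apply: (expz_order oN).
  rewrite PoszD expz_double em -expzM mulrAC -PoszM mulnC -eN expzM -expz_double expzD.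
  by case: oN => _ [/= -> _]; rewrite mulg1 exp1z.
rewrite dvdzE /= eN addnn -muln2 dvdn_pmul2l // => /(dvdn_leq (isT : 0 < 2)).
by case: r oddr {eN em} => [|[|[|]]].
Qed.

Lemma inverting_structure x n : a ^ x = a^-1 -> has_order x (2 ^ n)%N ->
  let A b := commute b a /\ b ^ x = b^-1 in
  [/\ is_subgroup A,
      forall g, exists2 y, A y & exists m, g = y * expz x m
    & forall b, A b -> b * b = 1 -> b = 1 \/ b = x ^+ (2 ^ n.-1)%N].
Proof.
move=> ex ox A.
have sC := sub_Ca; have cxx := sqr_central ex.
have Cxx : commute (x * x) a by apply: cxx.
have mem_central z : central z -> exists m, z = expz (x * x) m.
  by move=> /(central_odd_power (isT : odd 1) ex) [m ->]; exists (1 * m)%R.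
have CJ b g : commute b a -> commute (b ^ g) a.
  move=> ba; case: (conj_a g) => eg.
    by apply: commute_sym; rewrite -eg /commute -!conjMg ba.
  apply/commute_sym; rewrite -[X in commute X]invgK -eg.
  by apply/commute_sym/commuteV; rewrite /commute -!conjMg ba.
split.
- split; first by split; [exact: (sub1 sC) | rewrite conj1g invg1].
  split=> [u v [ua eu] [va ev]|u [ua eu]].
    split; first exact: (subM sC).
    by rewrite conjMg eu ev -invgM (abC va ua).
  by split; [exact: (subV sC) | rewrite conjVg eu].
- suff hC b : commute b a -> exists2 y, A y & exists m, b = y * expz x m.
    move=> g; case: (commute_or_invert g) => [/hC //|eg].
    have [y Ay [m em]] := hC _ (inverting_div ex eg).
    by exists y => //; exists (m + 1)%R; rewrite expzD mulgA -em mulgVK.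
  move=> ba.
  have cbb : central (b * b ^ x).
    apply: (centralI ex); first by apply: (subM sC) => //; apply: CJ.
    apply: Jcommute; rewrite conjMg -conjgM.
    by rewrite (commuteJ (commute_sym (cxx b))); apply: abC => //; apply: CJ.
  have [m em] := mem_central _ cbb.
  (* The exponent must be even so that half of it, still a power of the central [x * x], can be
     removed from [b]. *)
  have [k ek] : exists k, b * b ^ x = expz (x * x) (k + k)%R.
    have [k [e|e]] := int_parity m; first by exists k; rewrite em e.
    (* For odd [m], [x * b] also inverts [a], so [x ^ 2] is a power of its square, which is
       [x ^ (2 (1 + m))]. As [1 + m] is even and [x] has 2-power order, [x ^ 2 = 1]. *)
    exists 0%R; rewrite em; suff -> : x * x = 1 by rewrite !exp1z.
    have exb : a ^ (x * b) = a^-1 by rewrite conjgM ex; apply/commuteJ/commute_sym/commuteV.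
    have exb2 : (x * b) * (x * b) = expz (x * x) (1 + m)%R.
      rewrite expzD expz1 -em (abC ba (CJ _ x ba)) conjgE !mulgA mulgK.
      by rewrite -!mulgA.
    have [t et] := central_odd_power (isT : odd 1) exb cxx.
    rewrite mul1r exb2 -expzM in et.
    have : expz x (2%:Z * (1 - (1 + m) * t))%R = 1.
      by rewrite expzM /= expg2 expzD expzN -et mulgV.
    move=> /(expz_order ox); case: n ox => [|[|n]] ox.
    + by case: ox => _ []; rewrite expn0 expg1 => -> _; rewrite mulg1.
    + by case: ox => _ []; rewrite expn1 expg2.
    + rewrite e => /dvdzP [q]; rewrite !expnS !PoszM => eq; exfalso.
      have : (1 = 2%:Z * ((k + 1) * t + q * (2 ^ n)%N%:Z))%R by lia.
      by lia.
  exists (b * expz (x * x) (- k)%R); last first.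
    by exists (k + k)%R; rewrite expz_double -mulgA -expzD addNr mulg1.
  split; first by apply: (subM sC) => //; apply: (subZ sC).
  have cz g : commute (expz (x * x) (- k)%R) g by apply/commute_sym/commuteZ/commute_sym/cxx.
  apply/esym/mulg1_eq; rewrite conjMg (commuteJ (cz x)).
  move: (b ^ x) ek => u ek; rewrite -mulgA (cz (u * _)) !mulgA ek -!expzD.
  by rewrite (_ : k + k + - k - k = 0)%R //; lia.
- move=> b [ba ebx] bb.
  have cb : central b.
    apply: (centralI ex) => //; apply: Jcommute; rewrite ebx.
    exact: mulg1_eq.
  have [k ek] := mem_central _ cb; rewrite -expz_double in ek.
  have /(expz_order ox) : expz x (4%:Z * k)%R = 1.
    by rewrite -bb ek -expzD; congr expz; lia.
  case: n ox => [|n] ox.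
    by move=> _; left; rewrite ek; case: ox => _ []; rewrite expn0 expg1 => -> _; rewrite exp1z.
  move=> /dvdzP [c]; rewrite expnS PoszM => ec.
  have {}ec : (k + k = (2 ^ n)%N%:Z * c)%R by lia.
  have ex2 : x ^+ (2 ^ n)%N * x ^+ (2 ^ n)%N = 1.
    by rewrite -expgnDr addnn -mul2n -expnS; case: ox => _ [].
  rewrite ek ec expzM expz_nat /=.
  have [t [->|->]] := int_parity c; last rewrite expzD.
    by rewrite expz_double ex2 exp1z; left.
  by rewrite expz_double ex2 exp1z mul1g; right.
Qed.

End InvertingElement.

(** * Abelian subgroups as additive groups *)

Section AbelianSubgroup.
Variable gT : groupType.
Variable A : gT -> Prop.
Hypothesis sA : is_subgroup A.
Hypothesis cA : forall x y, A x -> A y -> commute x y.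

(* The vacuous dependence on [sA] and [cA] lets unification find the [zmodType] structure. *)
Definition absub : Type := let _ := sA in let _ := cA in {x : gT | `[< A x >]}.

HB.instance Definition _ := Choice.copy absub {x : gT | `[< A x >]}.

Definition abval (u : absub) : gT := sval u.

Definition abelem x (Ax : A x) : absub := exist _ x (asboolT Ax).

Lemma abvalP u : A (abval u). Proof. exact/asboolP/(svalP u). Qed.

Lemma abval_inj : injective abval. Proof. exact: val_inj. Qed.

Definition abzero : absub := abelem (sub1 sA).
Definition abopp (u : absub) : absub := abelem (subV sA (abvalP u)).
Definition abadd (u v : absub) : absub := abelem (subM sA (abvalP u) (abvalP v)).

Lemma abaddA : associative abadd.
Proof. by move=> u v w; apply: abval_inj; rewrite /= mulgA. Qed.
Lemma abaddC : commutative abadd.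
Proof. by move=> u v; apply: abval_inj; apply: cA; apply: abvalP. Qed.
Lemma abadd0 : left_id abzero abadd.
Proof. by move=> u; apply: abval_inj; rewrite /= mul1g. Qed.
Lemma abaddN : left_inverse abzero abopp abadd.
Proof. by move=> u; apply: abval_inj; rewrite /= mulVg. Qed.

HB.instance Definition _ := GRing.isZmodule.Build absub abaddA abaddC abadd0 abaddN.

Lemma abvalD (u v : absub) : abval (u + v)%R = abval u * abval v. Proof. by []. Qed.
Lemma abvalN (u : absub) : abval (- u)%R = (abval u)^-1. Proof. by []. Qed.
Lemma abvalMn (u : absub) n : abval (u *+ n)%R = abval u ^+ n.
Proof. by elim: n => [|n IH]; rewrite ?mulr0n // mulrS expgS -IH. Qed.
Lemma abvalZ (u : absub) m : abval (u *~ m)%R = expz (abval u) m.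
Proof. case: m => n; first exact: abvalMn.
by rewrite NegzE mulrNz abvalN expzN -pmulrn abvalMn. Qed.

Lemma abelem_ex x : A x -> exists u : absub, abval u = x.
Proof. by move=> Ax; exists (abelem Ax). Qed.

Lemma abseq_ex (s : seq gT) : (forall i, i < size s -> A (nth 1 s i)) ->
  exists t : seq absub, map abval t = s.
Proof.
elim: s => [|x s IH] hs; first by exists [::].
have [|t <-] := IH; first by move=> i; apply: (hs i.+1).
by have [u /= <-] := abelem_ex (hs 0 isT); exists (u :: t).
Qed.

Lemma abval_eq1 (u : absub) : abval u = 1 <-> u = 0%R.
Proof. by split=> [e|-> //]; apply: abval_inj. Qed.

Lemma cyc_product_cons (g : gT) s z : cyc_product (g :: s) z <->
  exists m, exists2 y, cyc_product s y & z = expz g m * y.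
Proof.
split=> [[cs [sz [hc ->]]]|[m [y [cs [sz [hc ->]]] ->]]].
  case: cs sz hc => [//|c cs] [sz] hc.
  have [m em] := (in_cyclicP _ _).1 (hc 0 isT); exists m.
  exists (\prod_(c <- cs) c); last by rewrite big_cons -em.
  by exists cs; split=> //; split=> // i; apply: (hc i.+1).
exists (expz g m :: cs); split; first by rewrite /= sz.
split; last by rewrite big_cons.
by case=> [_|i /hc //]; apply/in_cyclicP; exists m.
Qed.

Lemma cyc_product_span (s : seq absub) (z : gT) :
  cyc_product (map abval s) z <-> exists2 u, span s u & abval u = z.
Proof.
elim: s z => [|g s IH] z.
  split; first by move=> [[|c cs] [// _ [_ ->]]]; exists 0%R; rewrite ?big_nil.
  by move=> [u -> <-]; exists [::]; rewrite big_nil.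
rewrite [map _ _]/= cyc_product_cons; split.
  move=> [m [y /IH [u hu <-] ->]]; exists (g *~ m + u)%R; first by exists m, u.
  by rewrite abvalD abvalZ.
move=> [v [m [u hu ->]] <-]; exists m, (abval u); first by apply/IH; exists u.
by rewrite abvalD abvalZ.
Qed.

(** Peeling off the head turns the condition on all components of a trivial product into the
    recursive one. *)
Lemma direct_cyc_indep (s : seq absub) : direct_cyc (map abval s) <-> indep s.
Proof.
split=> [[_ hd]|hs].
  elim: s hd => // g s IH hd; split.
    move=> m z hz e.
    have [cs [sz [hc ec]]] : cyc_product (map abval s) (abval z).
      by apply/cyc_product_span; exists z.
    have := hd (expz (abval g) m :: cs) _ _ _ 0 isT.
    rewrite -abvalZ => h; apply/abval_eq1/h; first by rewrite /= sz.
      case=> [_|i hi]; last exact: hc.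
      by apply/in_cyclicP; exists m; rewrite abvalZ.
    by rewrite big_cons -ec -abvalD e.
  apply: IH => cs sz hc ec i ics.
  apply: (hd (1 :: cs) _ _ _ i.+1) => //; first by rewrite /= sz.
    case=> [_|j hj]; last exact: hc.
    by apply/in_cyclicP; exists 0%R.
  by rewrite big_cons mul1g.
split.
  move=> i j; rewrite size_map => hi hj.
  by rewrite !(nth_map 0%R) //; apply: cA; apply: abvalP.
elim: s hs => [|g s IH] hs; first by case.
move=> [//|c cs] /= [sz] hc; rewrite big_cons => e.
have [m /= em] := (in_cyclicP _ _).1 (hc 0 isT).
have : cyc_product (map abval s) (\prod_(c <- cs) c).
  by exists cs; split=> //; split=> // i; apply: (hc i.+1).
move=> /cyc_product_span [u hu eu].
case: hs => hg hs.
have g0 : (g *~ m)%R = 0%R.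
  by apply: (hg m u hu); apply/abval_eq1; rewrite abvalD abvalZ eu -em.
have c1 : c = 1 by rewrite em -abvalZ g0.
case=> [_ //|i hi]; apply: (IH hs cs sz _ _ i hi); first by move=> j; apply: (hc j.+1).
by rewrite c1 mul1g in e.
Qed.

Lemma has_order_abval (u : absub) n : has_order (abval u) n <-> add_order u n.
Proof.
split=> [[n0 [e h]]|[n0 e h]].
  split=> //; first by apply/abval_eq1; rewrite abvalMn.
  by move=> k /h h'; apply/eqP => /abval_eq1; rewrite abvalMn.
split=> //; split; first by rewrite -abvalMn e.
by move=> k /h /eqP h'; rewrite -abvalMn => /abval_eq1.
Qed.

Lemma odd_or_inf_abval (u : absub) : odd_or_inf u <->
  (infinite_order (abval u) \/ exists2 m, odd m & has_order (abval u) m).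
Proof.
split=> -[h|[m om hm]]; [left|right|left|right].
- by move=> k /h /eqP h'; rewrite -abvalMn => /abval_eq1.
- by exists m => //; apply/has_order_abval.
- by move=> k /h h'; apply/eqP => /abval_eq1; rewrite abvalMn.
- by exists m => //; apply/has_order_abval.
Qed.

(** Each cyclic factor, intersected with [A], contributes one generator. *)
Lemma chain_span (S : nat -> gT -> Prop) k : chain S k -> exists s : seq absub, forall u, span s u.
Proof.
move=> [sS S0 Sk Smono Sf].
suff h i : exists s : seq absub, forall u, S i (abval u) -> span s u.
  by have [s hs] := h k; exists s => u; apply/hs/Sk.
elim: i => [|i [s hs]]; first by exists [::] => u /S0 /abval_eq1.
have [sN nN] := sS i.
have /cyclic_factorP [y [_ Ay] hy] :=
  cyclic_factor_capp sN nN (sS i.+1).1 sA (Sf i).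
have [v ev] := abelem_ex Ay.
exists (v :: s) => u Su.
have [m [hm _]] := hy _ (conj Su (abvalP u)).
exists m, (u - v *~ m)%R; last by rewrite addrC subrK.
by apply: hs; rewrite abvalD abvalN abvalZ ev.
Qed.

End AbelianSubgroup.

Arguments abval {gT A sA cA} u.

(** * Generalized dihedral structure *)

(** [x ^ 2] is central, and every element is even or odd according to an exponent of [x]. A
    nonabelian [H] contains an odd element, hence [x ^ 2]. An element centralizing [H] must be even,
    and modulo powers of [x ^ 2] it is some [b] in [P] with [b ^ 2 = 1]. *)
Lemma dihedral_self_centralizing (gT : groupType) (P : gT -> Prop) (x : gT) (n : nat) :
  has_order x (2 ^ n)%N -> is_subgroup P ->
  (forall y z, P y -> P z -> commute y z) -> (forall y, P y -> y ^ x = y^-1) ->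
  (forall y, P y -> y * y = 1 -> y = 1 \/ y = x ^+ (2 ^ n.-1)%N) ->
  (forall g, exists2 y, P y & exists m, g = y * expz x m) ->
  forall H : gT -> Prop, is_subgroup H -> nonabelian H -> centralizer_le H.
Proof.
move=> ox sP cP invP involP decomp H sH [u [v [Hu [Hv nuv]]]] g cg.
have centralP z : (forall y, P y -> commute z y) -> commute z x -> forall k, commute z k.
  move=> zP zx k; have [y Py [m ->]] := decomp k.
  by apply: commuteM; [apply: zP | apply: commuteZ].
have xx_central k : commute (x * x) k.
  apply: centralP; last exact/commute_sym/commuteM.
  move=> y Py; apply/commute_sym/Jcommute.
  by rewrite conjgM !invP ?invgK //; apply: subV.
have c_central q k : commute (expz (x * x) q) k by apply/commute_sym/commuteZ/commute_sym.
have xP y : P y -> x * y = y^-1 * x.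
  by move=> Py; rewrite [RHS]conjgC conjVg invP // invgK.
pose even k := exists2 y, P y & exists q, k = expz (x * x) q * y.
pose odd k := exists2 y, P y & exists q, k = expz (x * x) q * (y * x).
have parity k : even k \/ odd k.
  have [y Py [m ->]] := decomp k; have [q [->|->]] := int_parity m.
    by left; exists y => //; exists q; rewrite expz_double (c_central q y).
  right; exists y => //; exists q; rewrite expzD expz_double mulgA -(c_central q y).
  by rewrite mulgA.
have even_commute k l : even k -> even l -> commute k l.
  move=> [y Py [q ->]] [z Pz [r ->]]; apply: commuteM; first exact/commute_sym.
  by apply: commute_sym; apply: commuteM; [apply/commute_sym | apply: cP].
have [p [Hp [y0 Py0 [q0 ep]]]] : exists p, H p /\ odd p.
  case: (parity u) => [eu|]; last by exists u.
  case: (parity v) => [ev|]; last by exists v.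
  by case: nuv; apply: even_commute.
(* [p ^+ 2] is an odd power of [x ^ 2], whose order divides [2 ^ n]; Bezout recovers [x ^ 2]. *)
have Hxx : H (x * x).
  have epp : p ^+ 2 = expz (x * x) (q0 + q0 + 1)%R.
    rewrite ep expgMn // expzD; congr (_ * _); first by rewrite expzD expg2.
    by rewrite expg2 expz1 -mulgA (mulgA x y0) (xP y0) // -mulgA mulVKg.
  have [i [j eij]] : exists i j : int, (i * (q0 + q0 + 1) + j * (2 ^ n)%N%:Z = 1)%R.
    have [i [j eij]] := Bezoutz (q0 + q0 + 1)%R (2 ^ n)%N; exists i, j; rewrite eij.
    rewrite /gcdz absz_nat; suff /eqP -> : coprime `|(q0 + q0 + 1)%R| (2 ^ n) by [].
    by rewrite coprimeXr // coprime_sym coprime2n; lia.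
  have -> : x * x = expz (p ^+ 2) i.
    have e1 : expz (x * x) (i * (q0 + q0 + 1) + j * (2 ^ n)%N%:Z)%R = x * x by rewrite eij.
    rewrite epp -expzM; apply: etrans (esym e1) _.
    rewrite expzD [(j * _)%R]mulrC [expz _ (_ * j)%R]expzM.
    have -> : expz (x * x) (2 ^ n)%N = 1.
      by case: ox => _ [e _]; rewrite expMz // expz_nat e mulg1.
    by rewrite exp1z mulg1 mulrC.
  by apply: (subZ sH); apply: (subX sH).
have Hc q : H (expz (x * x) q) by apply: (subZ sH).
(* If [g] is odd, [x] is a product of [g], a central element and an element of [P], so an even
   element of [H], commuting with [g], also commutes with [x]. This makes [H] abelian, as the
   quotient of two odd elements is even. *)
have even_central k : odd g -> H k -> even k -> forall l, commute k l.
  move=> [b Pb [q eg]] Hk [y Py [r ek]].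
  have Hy : H y by apply: (subMl sH (Hc r)); rewrite -ek.
  have cyx : commute y x.
    have -> : x = b^-1 * (expz (x * x) (- q)%R * g).
      by rewrite eg expzN mulKg mulKg.
    apply: commuteM; first exact/commuteV/cP.
    by apply: commuteM; [apply/commute_sym | apply/commute_sym/cg].
  by move=> l; rewrite ek; apply/commute_sym/commuteM; apply/commute_sym => //;
    apply: centralP => // z Pz; apply: cP.
have [eg|og] := parity g; last first.
  case: nuv; rewrite -/(commute u v).
  case: (parity u) => [/(even_central u og Hu) //|[y Py [q eu]]].
  case: (parity v) => [ev|[z Pz [r ev]]].
    exact/commute_sym/(even_central v og Hv ev).
  have euv : even (u * v^-1).
    exists (y * z^-1); first by apply: (subM sP) => //; apply: subV.
    exists (q - r)%R; rewrite eu ev invgM (invgM z x) expzD -!mulgA mulVKg.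
    by congr (_ * _); rewrite (c_central (- r)%R) expzN mulgA.
  rewrite -(mulgVK v u); apply/commute_sym/commuteM => //; apply/commute_sym.
  by apply: (even_central _ og) => //; apply: (subM sH) => //; apply: subV.
case: eg => b Pb [q eg]; rewrite eg; apply: (subM sH) => //.
have cbx : commute b x.
  have cbp : commute b p.
    have -> : b = expz (x * x) (- q)%R * g by rewrite eg mulgA -expzD addNr mul1g.
    by apply: commute_sym; apply: commuteM; apply: commute_sym; [exact: c_central | exact: cg].
  have -> : x = y0^-1 * (expz (x * x) (- q0)%R * p).
    by rewrite ep expzN mulKg mulKg.
  apply: commuteM; first exact/commuteV/cP.
  by apply: commuteM => //; apply/commute_sym.
have bb : b * b = 1.
  have := invP b Pb; rewrite commuteJ // => e; by rewrite {1}e mulVg.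
case: (involP b Pb bb) => [->|eb]; first exact: (sub1 sH).
(* For [n = 0], [x = 1]; for [n = 1], [b = x] lies in [P] and the whole group is abelian; for larger
   exponents [b] is a power of [x ^ 2]. *)
case: n ox eb {involP} => [|[|n]] ox eb.
- rewrite eb; case: ox => _ []; rewrite expn0 expg1 => -> _.
  by rewrite ?expg1n; exact: (sub1 sH).
- case: nuv; rewrite -/(commute u v); rewrite expg1 in eb.
  have cx k : commute x k by apply: centralP => // y Py; rewrite -eb; apply: cP.
  have [y Py [i ->]] := decomp u; have [z Pz [j ->]] := decomp v.
  apply: commuteM; last exact/commuteZ/commute_sym/cx.
  apply: commute_sym; apply: commuteM; last exact/commuteZ/commute_sym/cx.
  exact: cP.
- by rewrite eb /= expnS expgnA expg2; apply: (subX sH).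
Qed.

Lemma dihedral_structure (gT : groupType) :
  supersoluble gT -> infinite_group gT -> nonabelian (@whole_group gT) ->
  (forall H : gT -> Prop, is_subgroup H -> nonabelian H -> centralizer_le H) ->
  exists (x : gT) (n : nat) (a : seq gT) (d : gT) (h : nat),
     has_order x (2 ^ n)%N /\
     direct_cyc (rcons a d) /\
     (forall i, i < size a ->
        infinite_order (nth 1 a i) \/
        exists2 m, odd m & has_order (nth 1 a i) m) /\
     has_order d (2 ^ h)%N /\
     (0 < h -> d ^+ (2 ^ h.-1)%N = x ^+ (2 ^ n.-1)%N) /\
     (forall y, cyc_product (rcons a d) y -> y ^ x = y^-1) /\
     (forall g, exists2 y, cyc_product (rcons a d) y &
                   exists2 c, in_cyclic x c & g = y * c).
Proof.
move=> /supersoluble_chain [S [k chS]] inf [u [v [_ [_ nuv]]]] self_cent.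
have [c [inf_c conj_c]] := exists_normal_infinite_cyclic chS inf.
have abC := abelian_centralizer chS self_cent inf_c.
(* Otherwise the whole group would be [C(c)], which is abelian. *)
have [x ex] : exists x, c ^ x = c^-1.
  apply: contrapT => no; apply: nuv; apply: abC.
    by case: (commute_or_invert conj_c u) => // e; case: no; exists u.
  by case: (commute_or_invert conj_c v) => // e; case: no; exists v.
have [n ox] := inverting_order self_cent inf_c conj_c abC ex.
have [sA decomp invol] := inverting_structure self_cent inf_c conj_c abC ex ox.
set A := fun b => _ in sA decomp invol.
have cA y z : A y -> A z -> commute y z by move=> [yc _] [zc _]; apply: abC.
have [s0 hs0] := chain_span sA cA chS.
have [s [hs inds]] := span_basis s0.
(* This gives both the uniqueness of the involution needed for the 2-part and, later, the value of
   [d ^+ (2 ^ h.-1)]. *)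
have double1 (w : absub sA cA) : (w + w = 0)%R -> (w != 0)%R ->
    abval w = x ^+ (2 ^ n.-1)%N.
  move=> ww w0; case: (invol (abval w) (abvalP w)) => //.
    by rewrite -abvalD ww.
  by move=> /abval_eq1 e; rewrite e eqxx in w0.
have [|d [t [h [hdt idt ot od]]]] := two_part_basis _ inds.
  by move=> w w' ww ww' w0 w0'; apply: abval_inj; rewrite !double1.
have spanA y : A y -> cyc_product (rcons (map abval t) (abval d)) y.
  move=> Ay; have [w ew] := abelem_ex sA cA Ay.
  rewrite -map_rcons; apply/cyc_product_span; exists w => //.
  apply/(eq_mem_span (t := d :: t)); first by move=> z; rewrite mem_rcons.
  by apply/hdt/hs.
exists x, n, (map abval t), (abval d), h; split=> //.
split; first by rewrite -map_rcons; apply/direct_cyc_indep/indep_rcons.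
split.
  move=> i; rewrite size_map => it; rewrite (nth_map 0%R) //.
  by apply/odd_or_inf_abval/ot/mem_nth.
split; first exact/has_order_abval.
split.
  case: h od => // h od _; rewrite -abvalMn.
  have [_ e min] : add_order (d *+ 2 ^ h)%R 2 by apply: add_order_mulrn; rewrite -expnSr.
  by apply: double1; [rewrite -mulr2n | have := min 1%N isT; rewrite mulr1n].
split.
  by move=> y; rewrite -map_rcons => /cyc_product_span [w _ <-]; case: (abvalP w).
move=> g; have [y Ay [m ->]] := decomp g.
by exists y; [exact: spanA | exists (expz x m) => //; apply/in_cyclicP; exists m].
Qed.

Theorem theorem4p2 (gT : groupType) :
  supersoluble gT -> infinite_group gT -> nonabelian (@whole_group gT) ->
  (forall H : gT -> Prop, is_subgroup H -> nonabelian H -> centralizer_le H)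
  <->
  (exists (x : gT) (n : nat) (a : seq gT) (d : gT) (h : nat),
     has_order x (2 ^ n)%N /\
     direct_cyc (rcons a d) /\
     (forall i, i < size a ->
        infinite_order (nth 1 a i) \/
        exists2 m, odd m & has_order (nth 1 a i) m) /\
     has_order d (2 ^ h)%N /\
     (0 < h -> d ^+ (2 ^ h.-1)%N = x ^+ (2 ^ n.-1)%N) /\
     (forall y, cyc_product (rcons a d) y -> y ^ x = y^-1) /\
     (forall g, exists2 y, cyc_product (rcons a d) y &
                   exists2 c, in_cyclic x c & g = y * c)).
Proof.
move=> ssol inf nab; split; first exact: dihedral_structure.
move=> [x [n [a [d [h [ox [dir [oa [od [dx [invx decomp]]]]]]]]]]].
pose gen z := z \in rcons a d.
have gen_comm y z : gen y -> gen z -> commute y z.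
  by move=> /(nthP 1) [i hi <-] /(nthP 1) [j hj <-]; apply: dir.1.
(* The double centralizer of commuting generators is an abelian subgroup containing them; inside it
   [cyc_product] becomes [span]. *)
pose A := centralizer (centralizer gen).
have sA : is_subgroup A by exact: sub_centralizer.
have genA z : gen z -> A z by move=> hz w cw; apply/commute_sym/cw.
have cA y z : A y -> A z -> commute y z.
  by move=> Ay Az; apply: Ay => w hw; apply: Az => w' hw'; apply: gen_comm.
have [t et] : exists t : seq (absub sA cA), map abval t = a.
  by apply: abseq_ex => i hi; apply: genA; rewrite /gen mem_rcons inE mem_nth ?orbT.
have [e ee] : exists e : absub sA cA, abval e = d.
  by apply: abelem_ex; apply: genA; rewrite /gen mem_rcons mem_head.
rewrite -{}et -{}ee -?map_rcons in dir oa od dx invx decomp.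
move/direct_cyc_indep/indep_rcons: dir => ide.
have span_rcons w : span (rcons t e) w <-> span (e :: t) w.
  by apply: eq_mem_span => z; rewrite mem_rcons.
apply: (@dihedral_self_centralizing _ (cyc_product (map abval (rcons t e))) x n) => //.
- split; first by apply/cyc_product_span; exists 0%R => //; exact: span0.
  split=> [y z /cyc_product_span [u hu <-] /cyc_product_span [v hv <-]
         |y /cyc_product_span [u hu <-]]; apply/cyc_product_span.
    by exists (u + v)%R => //; apply: spanD.
  by exists (- u)%R => //; apply: spanN.
- move=> y z /cyc_product_span [u _ <-] /cyc_product_span [v _ <-].
  exact: (cA _ _ (abvalP u) (abvalP v)).
- move=> y /cyc_product_span [u /span_rcons hu <-]; rewrite -abvalD => /abval_eq1 uu.
  have ot w : w \in t -> odd_or_inf w.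
    move=> /(nthP 0%R) [i it <-]; apply/odd_or_inf_abval.
    by have := oa i; rewrite size_map (nth_map 0%R) //; apply.
  have [->|[h0 ->]] := span_double ide ot ((has_order_abval _ _).1 od) hu uu; first by left.
  by right; rewrite abvalMn dx.
- move=> g; have [y hy [c /in_cyclicP [m ->] ->]] := decomp g.
  by exists y => //; exists m.
Qed.
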